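(* For every dimension $n$ there exists a constant $C_n$, depending only on $n$, such that the following holds. Let $\Omega\subset\mathbb{R}^n$ be a bounded convex domain, and let $K$ be a John ellipsoid associated to $\Omega$ whose axes lie along the coordinate axes, the axis in the $x_j$-direction having length $N_j$, with $N_1\geq N_2\geq\cdots\geq N_n$. Let $u$ be the first Dirichlet eigenfunction of the Laplacian on $\Omega$. Then for each $j$ with $1\leq j\leq n$, $$\|\partial_{x_j}u\|_{L^2(\Omega)} \leq C_n\, N_n^{-1}\left(\frac{N_j}{N_n}\right)^{-1/3}\|u\|_{L^2(\Omega)}.$$
   Context: The first Dirichlet eigenfunction $u$ of $\Omega$ satisfies $(\Delta+\lambda)u=0$ in $\Omega$ and $u=0$ on $\partial\Omega$, where $\lambda$ is the first eigenvalue of the Dirichlet Laplacian on $\Omega$; it is chosen with $u>0$ in $\Omega$. An ellipsoid $K$ is called a John ellipsoid associated to $\Omega\subset\mathbb{R}^n$ if $K$ is contained in $\Omega$ and the dilation of $K$ about its centre with scaling factor $n$ contains $\Omega$. *)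

(* Defs.v *)
From HB Require Import structures.
From mathcomp Require Import all_boot all_order all_algebra.
From mathcomp Require Import all_classical all_reals all_analysis.

Set Implicit Arguments.
Unset Strict Implicit.
Unset Printing Implicit Defensive.

Import Order.TTheory GRing.Theory Num.Theory.
Import numFieldNormedType.Exports.

Local Open Scope classical_set_scope.
Local Open Scope ring_scope.

Definition measure_rV_display : measure_display.
Proof. exact: default_measure_display. Qed.

Section measurable_rV.
Context {R : realType}.
Variable n : nat.

Definition coord_rV (i : 'I_n) (v : 'rV[R]_n) : R := v ord0 i.

Let rV_set0 : g_sigma_preimage coord_rV set0.
Proof. exact: sigma_algebra0. Qed.

Let rV_setC A : g_sigma_preimage coord_rV A -> g_sigma_preimage coord_rV (~` A).
Proof. exact: sigma_algebraC. Qed.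

Let rV_bigcup (F : _^nat) : (forall i, g_sigma_preimage coord_rV (F i)) ->
  g_sigma_preimage coord_rV (\bigcup_i (F i)).
Proof. exact: sigma_algebra_bigcup. Qed.

(* The sigma-algebra on ['rV[R]_n] is the n-fold product of the Borel
   sigma-algebra of [R], as for tuples in the library. *)
HB.instance Definition _ := @isMeasurable.Build measure_rV_display
  'rV[R]_n (g_sigma_preimage coord_rV) rV_set0 rV_setC rV_bigcup.

Lemma measurable_coord_rV i : measurable_fun [set: 'rV[R]_n] (coord_rV i).
Proof.
move=> _ Y mY; rewrite setTI; apply: sub_sigma_algebra => /=.
rewrite -bigcup_seq/=; exists i => /=; first by rewrite mem_index_enum.
by exists Y => //; rewrite setTI.
Qed.

Lemma measurable_fun_rVP d (T : measurableType d) (f : T -> 'rV[R]_n) :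
  (forall i, measurable_fun [set: T] (coord_rV i \o f)) ->
  measurable_fun [set: T] f.
Proof.
move=> mf.
suff H : g_sigma_preimage (fun i => coord_rV i \o f) `<=` measurable.
  by move=> _ A mA; apply: H; rewrite g_sigma_preimage_comp; exists A.
apply: smallest_sub; first exact: sigma_algebra_measurable.
elim/big_ind: _ => // [A B hA hB C []|i _]; [exact: hA|exact: hB|].
by move=> A [B mB <-]; exact: mf.
Qed.

End measurable_rV.

Section lebesgue_rV.
Context {R : realType}.

Definition cons_rV n (p : measurableTypeR R * 'rV[R]_n) : 'rV[R]_n.+1 :=
  \row_i (if unlift ord0 i is Some j then p.2 ord0 j else p.1).

Definition uncons_rV n (v : 'rV[R]_n.+1) : measurableTypeR R * 'rV[R]_n :=
  (v ord0 ord0, \row_j v ord0 (lift ord0 j)).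

Lemma cons_rVK n : cancel (@cons_rV n) (@uncons_rV n).
Proof.
move=> [a w]; rewrite /uncons_rV /cons_rV !mxE unlift_none; congr (_, _).
by apply/rowP => j; rewrite !mxE liftK.
Qed.

Lemma uncons_rVK n : cancel (@uncons_rV n) (@cons_rV n).
Proof.
move=> v; apply/rowP => i; rewrite !mxE /=.
by case: unliftP => [j ->|->]; rewrite ?mxE.
Qed.

Lemma measurable_cons_rV n : measurable_fun [set: measurableTypeR R * 'rV[R]_n] (@cons_rV n).
Proof.
apply: measurable_fun_rVP => i.
case: (unliftP ord0 i) => [j ij|i0].
  rewrite (_ : _ \o _ = coord_rV j \o snd).
    exact: measurableT_comp (measurable_coord_rV j) _.
  by apply/funext => p; rewrite /coord_rV /= mxE ij liftK.
rewrite (_ : _ \o _ = fst) //.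
by apply/funext => p; rewrite /coord_rV /= mxE i0 unlift_none.
Qed.

Lemma measurable_uncons_rV n : measurable_fun [set: 'rV[R]_n.+1] (@uncons_rV n).
Proof.
apply/measurable_fun_pairP; split; first exact: (measurable_coord_rV ord0).
apply: measurable_fun_rVP => j.
rewrite (_ : _ \o _ = coord_rV (lift ord0 j)); first exact: measurable_coord_rV.
by apply/funext => v; rewrite /coord_rV /= mxE.
Qed.

Section succ.
Local Open Scope ereal_scope.
Variables (n : nat) (mu : {sigma_finite_measure set 'rV[R]_n -> \bar R}).

Let prod : {measure set (measurableTypeR R * 'rV[R]_n)%type -> \bar R} :=
  @lebesgue_measure R \x mu.

Definition lebesgue_rV_succ : set 'rV[R]_n.+1 -> \bar R :=
  pushforward prod (@cons_rV n).

Let succ0 : lebesgue_rV_succ set0 = 0.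
Proof. by rewrite /lebesgue_rV_succ /pushforward preimage_set0 measure0. Qed.

Let succ_ge0 A : 0 <= lebesgue_rV_succ A.
Proof. exact: (measure_ge0 prod). Qed.

Let mpre A : measurable A -> measurable (@cons_rV n @^-1` A).
Proof. by move=> mA; rewrite -[X in measurable X]setTI; exact: measurable_cons_rV. Qed.

Let succ_sigma_additive : semi_sigma_additive lebesgue_rV_succ.
Proof.
move=> F mF tF mUF; rewrite /lebesgue_rV_succ /pushforward preimage_bigcup.
apply: (measure_semi_sigma_additive (s := prod)).
- by move=> k; exact: mpre.
- apply/trivIsetP => /= i j _ _ ij; rewrite -preimage_setI.
  by move/trivIsetP : tF => /(_ _ _ _ _ ij) ->//; rewrite preimage_set0.
- by rewrite -preimage_bigcup; exact: mpre.
Qed.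

HB.instance Definition _ := isMeasure.Build _ _ _
  lebesgue_rV_succ succ0 succ_ge0 succ_sigma_additive.

Let succ_sigma_finite : sigma_finite setT lebesgue_rV_succ.
Proof.
have [F TF Foo] : sigma_finite setT prod.
  have /sigma_finiteP[F [TF ndF Foo]] := sigma_finiteT (@lebesgue_measure R).
  have /sigma_finiteP[G [TG ndG Goo]] := sigma_finiteT mu.
  exists (fun k => F k `*` G k).
    rewrite -setXTT TF TG predeqE => -[x y]; split.
      move=> [/= [i _ Fx] [k _ Gy]]; exists (maxn i k) => //; split.
      - by move: x Fx; exact/subsetPset/ndF/leq_maxl.
      - by move: y Gy; exact/subsetPset/ndG/leq_maxr.
    by move=> [i _ []/= ? ?]; split; exists i.
  move=> k; have [mF Fk] := Foo k; have [mG Gk] := Goo k.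
  split; first exact: measurableX.
  rewrite [ltLHS](product_measure1E (@lebesgue_measure R) mu mF mG).
  by rewrite lte_mul_pinfty// ge0_fin_numE.
exists (fun k => @uncons_rV n @^-1` F k).
  by rewrite -preimage_bigcup -TF preimage_setT.
move=> k; have [mF Fk] := Foo k; split.
  by rewrite -[X in measurable X]setTI; exact: measurable_uncons_rV.
rewrite /lebesgue_rV_succ /pushforward -comp_preimage.
by rewrite (_ : _ \o _ = id) ?preimage_id//; apply/funext => p /=; rewrite cons_rVK.
Qed.

HB.instance Definition _ := Measure_isSigmaFinite.Build _ _ _
  lebesgue_rV_succ succ_sigma_finite.

End succ.

Fixpoint lebesgue_rV n : {sigma_finite_measure set 'rV[R]_n -> \bar R} :=
  match n with
  | 0%N => dirac (0 : 'rV[R]_0)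
  | m.+1 => lebesgue_rV_succ (lebesgue_rV m)
  end.

Lemma lebesgue_rV_box n (a b : 'rV[R]_n) :
  (forall i, a ord0 i <= b ord0 i)%R ->
  lebesgue_rV n [set v | forall i, a ord0 i <= v ord0 i <= b ord0 i]%R =
    (\prod_(i < n) (b ord0 i - a ord0 i))%:E.
Proof.
elim: n => [|n IHn] in a b *.
  move=> _; rewrite big_ord0 /= diracE mem_set//=.
  by move=> [].
move=> ab; set B := [set v | _].
pose C := [set v : 'rV[R]_n | forall i,
  (uncons_rV a).2 ord0 i <= v ord0 i <= (uncons_rV b).2 ord0 i]%R.
have BE : @cons_rV n @^-1` B = `[a ord0 ord0, b ord0 ord0]%classic `*` C.
  apply/seteqP; split => [[x v] /= h|[x v] /= [hx h] i].
    split; first by have := h ord0; rewrite mxE unlift_none in_itv.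
    by move=> i; have := h (lift ord0 i); rewrite !mxE liftK.
  rewrite mxE; case: unliftP => [j ->|->]; last by move: hx; rewrite in_itv.
  by have := h j; rewrite !mxE.
have mC : measurable C.
  rewrite (_ : C = \bigcap_(i in [set: 'I_n])
    (@coord_rV R n i @^-1` `[(uncons_rV a).2 ord0 i, (uncons_rV b).2 ord0 i])).
    apply: fin_bigcap_measurable => // i _; rewrite -[X in measurable X]setTI.
    exact: measurable_coord_rV.
  apply/seteqP; split => [v h i _|v h i] /=; first by rewrite in_itv; exact: h.
  by have := h i I; rewrite /= in_itv.
rewrite [LHS](_ : _ = (lebesgue_measure \x lebesgue_rV n)%E (@cons_rV n @^-1` B))//.
rewrite BE (product_measure1E lebesgue_measure)//= IHn => [|i]; last by rewrite !mxE.
rewrite lebesgue_measure_itv /= lte_fin big_ord_recl EFinM.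
congr (_ * _)%E.
  case: ltP => // ba; rewrite (_ : b _ _ = a ord0 ord0) ?subrr//.
  by apply/eqP; rewrite eq_le ba ab.
by congr EFin; apply: eq_bigr => i _; rewrite !mxE.
Qed.

End lebesgue_rV.

(* The function is extended by 0 outside of [Omega]. *)
Definition L2norm (R : realType) n (Omega : set 'rV[R]_n) (f : 'rV[R]_n -> R) :
  \bar R := 'N[lebesgue_rV n]_2%:E[EFin \o (f \_ Omega)]%E.

Section dirichlet.
Context {R : realType} {n : nat}.
Implicit Types (Omega : set 'rV[R]_n) (f u v : 'rV[R]_n -> R) (mu lambda : R).

Definition partial (j : 'I_n) f : 'rV[R]_n -> R :=
  fun x => 'D_(delta_mx ord0 j) f x.

Definition laplacian f : 'rV[R]_n -> R :=
  fun x => \sum_(j < n) partial j (partial j f) x.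

Definition C1_on Omega f := forall j x, Omega x ->
  derivable f x (delta_mx ord0 j) /\ {for x, continuous (partial j f)}.

Definition C2_on Omega f := C1_on Omega f /\ forall j, C1_on Omega (partial j f).

(* Since [Omega] will be open, its boundary is [closure Omega `\` Omega]. *)
Definition dirichlet_solution Omega mu v :=
  [/\ C2_on Omega v,
      {within closure Omega, continuous v},
      forall x, Omega x -> laplacian v x + mu * v x = 0
    & forall x, (closure Omega `\` Omega) x -> v x = 0].

Definition dirichlet_eigenvalue Omega mu := exists2 v,
  dirichlet_solution Omega mu v & exists2 x, Omega x & v x != 0.

Definition first_dirichlet_eigenvalue Omega lambda :=
  dirichlet_eigenvalue Omega lambda /\
  forall mu, dirichlet_eigenvalue Omega mu -> lambda <= mu.

Definition first_dirichlet_eigenfunction Omega u := exists2 lambda,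
  first_dirichlet_eigenvalue Omega lambda
  & dirichlet_solution Omega lambda u /\ forall x, Omega x -> 0 < u x.

End dirichlet.

Section john.
Context {R : realType} {n : nat}.
Implicit Types (Omega K : set 'rV[R]_n) (c : 'rV[R]_n).

(* [N j] is the full length of the axis in the j-th direction, so the semi-axes
   are [N j / 2]. The ellipsoid is open: for an open convex [Omega], the two
   inclusions of [john_ellipsoid] for a closed ellipsoid imply those for its
   interior, whereas a closed one would exclude every [Omega] when [n = 1]. *)
Definition axis_ellipsoid c (N : 'I_n -> R) : set 'rV[R]_n :=
  [set x | \sum_(j < n) ((x ord0 j - c ord0 j) / (N j / 2)) ^+ 2 < 1].

Definition dilation c (t : R) K : set 'rV[R]_n :=
  [set c + t *: (x - c) | x in K].

Definition john_ellipsoid Omega c K :=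
  K `<=` Omega /\ Omega `<=` dilation c n%:R K.

End john.

(* Main.v *)
Require Import Defs.
From mathcomp Require Import all_boot all_order all_algebra.
From mathcomp Require Import all_classical all_reals all_analysis.
From mathcomp Require Import measurable_realfun.
From mathcomp Require Import ring lra.

Set Implicit Arguments.
Unset Strict Implicit.
Unset Printing Implicit Defensive.

Import Order.TTheory GRing.Theory Num.Theory.
Import numFieldNormedType.Exports.

Local Open Scope classical_set_scope.
Local Open Scope ring_scope.

(** Write [E i] for the integral of the square of the [i]-th partial derivative
    of [u] and [V] for that of [u ^ 2].  Since the [E i] add up to [lambda * V],
    an upper bound for [E j] is the same as a lower bound for the energy in the
    other directions.  It comes from the variational character of [lambda], with
    test functions made of slices of [u] itself.

    Fix [0 < delta < 1] and [a = N j / 4].  The ellipsoid contains the segment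
    of the points [c + s e_j], [`|s| <= a], so by convexity [Omega] contains
    [(1 - delta) x + delta (c + s e_j)] for every [x] in [Omega].  Hence, for
    each [t], [Omega] contains the product of a segment of half-length
    [delta a] in direction [e_j] with a copy of the slice [x_j = t] of [Omega]
    shrunk by the factor [1 - delta].  On this product take a bump in the
    variable [s] times [u] on the slice: its Rayleigh quotient is at least
    [lambda], and integrating over [t] gives
    [lambda V <= (1 - delta)^-2 (sum of the E i, i != j) + 128 / (delta a)^2 V],
    so that [E j <= (2 delta lambda + 128 / (delta a)^2) V].  As [Omega]
    contains a ball of radius [N_n / 4], [lambda] is at most a constant times
    [N_n^-2], and [delta = (N j / N_n)^(-2/3) / 2] balances the two terms.

    Three points make this elementary.

    - The lower bound [lambda] for Rayleigh quotients only uses the positivity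
      of [u], through Picone's inequality (lemma [picone]): for [U > 0],
      [(d w)^2 + (d d U / U) w^2] is the sum of the derivative of
      [w^2 d U / U] and of a square, so its integral is nonnegative.  This
      holds direction by direction, and [U] may be [u] composed with an affine
      map that sends coordinate lines to coordinate lines.  Taking
      [U (s, x) = u ((1 - delta) x + delta (c + s e_j))] on a space of one more
      dimension, [s] becomes a coordinate, [t] is integrated together with the
      other ones, and no change of variables is needed (lemma
      [comparison_integral]).

    - Integrability of the gradient up to the boundary is not known in advance.
      One therefore replaces [u] by [F u], where [F] vanishes on [[0, e]] and
      [0 <= F' <= 1] (definition [cutoff]); all integrands are then continuous
      with compact support, and [e] tends to [0] only at the end, by monotone
      convergence (lemma [partial_energy_bound]).

    - The upper bound for [lambda] follows from the maximum principle: compare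
      [u] with an explicit function on a ball at a point where their quotient
      is maximal (lemma [eigenvalue_ball_bound]). *)

(** * Topology and measurability of row vectors *)

Section topology_rV.
Context {R : realType} {n : nat}.
Implicit Types (A : set 'rV[R]_n).

Lemma coord_le_norm (x : 'rV[R]_n) i : `|x ord0 i| <= `|x|.
Proof.
rewrite [leRHS]/Num.norm /= mx_normrE.
by apply/bigmax_geP; right => /=; exists (ord0, i).
Qed.

Lemma norm_lt_coord (x : 'rV[R]_n) e : 0 < e -> (forall i, `|x ord0 i| < e) -> `|x| < e.
Proof.
move=> e0 h; rewrite [ltLHS]/Num.norm /= mx_normrE.
by apply/bigmax_ltP; split=> // -[i j] _ /=; rewrite (ord1 i).
Qed.

(** The open boxes with rational centre and radius [1 / (k + 1)] form a
    countable base of the topology and are measurable. *)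
Lemma measurable_open_rV A : open A -> measurable A.
Proof.
move=> oA.
pose D (q : 'rV[rat]_n * nat) : set 'rV[R]_n :=
  [set x | forall i, `|x ord0 i - ratr (q.1 ord0 i)| < q.2.+1%:R^-1].
have mD q : measurable (D q).
  rewrite (_ : D q = \bigcap_(i in [set: 'I_n]) (@coord_rV R n i @^-1`
      [set t | `|t - ratr (q.1 ord0 i)| < q.2.+1%:R^-1])).
    apply: fin_bigcap_measurable => // i _; rewrite -[X in measurable X]setTI.
    apply: (measurable_coord_rV i) => //.
    have -> : [set t : R | `|t - ratr (q.1 ord0 i)| < q.2.+1%:R^-1] =
        ball (ratr (q.1 ord0 i) : R) q.2.+1%:R^-1.
      by apply/seteqP; split => t /=; rewrite -ball_normE/= distrC.
    by apply: open_measurable; exact: ball_open.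
  by apply/seteqP; split => [x h i _|x h i]; [exact: h|exact: (h i I)].
have -> : A = \bigcup_q (D q `&` [set _ | D q `<=` A]).
  apply/seteqP; split => [x Ax|x [q _ [Dx DA]]]; last exact: DA.
  have /nbhs_ballP[e /= e0 eA] : nbhs x A by exact: open_nbhs_nbhs.
  have [k _ /(_ _ (leqnn k)) ke] :=
    @near_infty_natSinv_lt R (PosNum (divr_gt0 e0 (ltr0n R 2))).
  have /= {}ke : k.+1%:R^-1 < e / 2 by exact: ke.
  have [q hq] : exists q : 'I_n -> rat, forall i,
      `|x ord0 i - ratr (q i)| < k.+1%:R^-1.
    suff /choice[q hq] : forall i : 'I_n, exists r : rat,
      `|x ord0 i - ratr r| < k.+1%:R^-1 by exists q.
    move=> i; have k0 : 0 < k.+1%:R^-1 :> R by rewrite invr_gt0.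
    have [r] := @rat_in_itvoo R (x ord0 i) (x ord0 i + k.+1%:R^-1) ltac:(by rewrite ltrDl).
    rewrite in_itv/= => /andP[h1 h2]; exists r.
    by rewrite ltr_distlC; apply/andP; split=> //; rewrite (lt_trans _ h1)// ltrBlDr ltrDl.
  exists (\row_i q i, k) => //; split => [i|y hy]; first by rewrite mxE /=.
  apply: eA; rewrite mx_norm_ball /ball_ /=; apply: norm_lt_coord => // i.
  have := hy i; rewrite !mxE /= => hyi; have hxi := hq i.
  apply: le_lt_trans (ler_distD (ratr (q i)) _ _) _; rewrite (distrC _ (y _ _)).
  by apply: lt_trans (ltrD hxi hyi) _; move: ke; move: (k.+1%:R^-1) => z; lra.
apply: countable_bigcupT_measurable => [|q]; first exact: countableP.
have [DA|nDA] := pselect (D q `<=` A).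
  rewrite (_ : _ `&` _ = D q)//; apply/seteqP; split => [x []//|x Dx]; by split.
by rewrite (_ : _ `&` _ = set0)//; apply/seteqP; split => [x []//|x].
Qed.

Lemma continuous_measurable_rV (f : 'rV[R]_n -> R) :
  continuous f -> measurable_fun setT f.
Proof.
move=> /continuousP cf.
apply: (measurability _ (RGenOpens.measurableE R)) => _ [_ [a [b ->] <-]].
by rewrite setTI; apply: measurable_open_rV; apply/cf; exact: interval_open.
Qed.

End topology_rV.

(** * Compactly supported functions and Fubini's theorem *)

Lemma continuous_at_rV {R : realType} {T : topologicalType} n (f : T -> 'rV[R]_n) x :
  (forall i, {for x, continuous (fun t => f t ord0 i)}) -> {for x, continuous f}.
Proof.
move=> cf A [P hP sPA].
apply: (filterS (fun y h => sPA (f y) h)).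
apply: filter_forall => i; apply: filter_forall => j.
by rewrite (ord1 i); apply: cf; have := hP i j; rewrite (ord1 i).
Qed.

Lemma closed_sublevel {R : realType} {T : topologicalType} (f : T -> R) a :
  continuous f -> closed [set x | f x <= a].
Proof.
move=> cf; apply: (@preimage_closed _ _ f [set y | y <= a]) => [x _|].
  exact: cf.
exact: closed_le.
Qed.

Section compactly_supported.
Context {R : realType}.

(** Continuity is part of the notion, so that a single hypothesis gives
    measurability, boundedness and integrability. *)
Definition compactly_supported (V : normedModType R) (f : V -> R) :=
  continuous f /\ exists M, forall x, M < `|x| -> f x = 0.

Local Notation cc := compactly_supported.

Lemma cc_bounded n (f : 'rV[R]_n -> R) : cc f -> exists B, forall x, `|f x| <= B.
Proof.
move=> [cf [M fM]].
pose A := [set x : 'rV[R]_n | `|x| <= `|M|].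
have cA : compact A.
  apply: bounded_closed_compact.
    by exists `|M|; split => // e he x /= hx; rewrite (le_trans hx)// ltW.
  by apply: closed_sublevel; exact: norm_continuous.
have /compact_bounded[B [_ hB]] : compact (f @` A).
  by apply: continuous_compact => //; exact: continuous_subspaceT.
exists (`|B| + 1) => x.
have [Mx|xM] := ltP M `|x|; first by rewrite fM// normr0 addr_ge0.
apply: (hB (`|B| + 1)); last by exists x => //=; rewrite /A /= (le_trans xM)// ler_norm.
by rewrite (le_lt_trans (ler_norm _))// ltrDl.
Qed.

Lemma cc_integrable n (f : 'rV[R]_n -> R) : cc f ->
  (lebesgue_rV n).-integrable setT (EFin \o f).
Proof.
move=> ccf; have [B fB] := cc_bounded ccf; have [cf [M fM]] := ccf.
pose A := [set x : 'rV[R]_n | forall i, (const_mx (- `|M|) : 'rV_n) ord0 i <= x ord0 i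
   <= (const_mx `|M| : 'rV_n) ord0 i].
have mA : measurable A.
  rewrite (_ : A = \bigcap_(i in [set: 'I_n])
    (@coord_rV R n i @^-1` `[- `|M|, `|M|])).
    apply: fin_bigcap_measurable => // i _; rewrite -[X in measurable X]setTI.
    exact: measurable_coord_rV.
  apply/seteqP; split => [v h i _|v h i] /=.
    by rewrite in_itv/=; have := h i; rewrite !mxE.
  by have := h i I; rewrite /= in_itv/= !mxE.
have muA : (lebesgue_rV n A < +oo)%E.
  rewrite (_ : lebesgue_rV n A = (\prod_(i < n)
      ((const_mx `|M| : 'rV_n) ord0 i - (const_mx (- `|M|) : 'rV_n) ord0 i))%:E).
    exact: ltry.
  by apply: lebesgue_rV_box => i; rewrite !mxE ge0_cp.
have -> : EFin \o f = (EFin \o f) \_ A.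
  apply/funext => x; rewrite patchE; case: ifPn => // /negP xA /=.
  rewrite fM//; rewrite ltNge; apply/negP => xM; apply: xA.
  apply/mem_set => i; rewrite !mxE -ler_norml.
  by rewrite (le_trans (coord_le_norm _ _))// (le_trans xM)// ler_norm.
apply: (iffLR (integrable_mkcond _ mA)).
apply: (@measurable_bounded_integrable _ _ _ (lebesgue_rV n) f A) => //.
- apply: measurable_funTS; exact: continuous_measurable_rV.
- by exists B; split => //; [exact: num_real|move=> e he x _; exact: le_trans (fB x) (ltW he)].
Qed.

Lemma norm_cons_rV_ge n (t : R) (v : 'rV[R]_n) : `|v| <= `|cons_rV (t, v)|.
Proof.
rewrite [leLHS]/Num.norm /= mx_normrE; apply/bigmax_leP; split=> // -[i j] _ /=.
rewrite (ord1 i); apply: le_trans (coord_le_norm _ (lift ord0 j)).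
by rewrite mxE liftK.
Qed.


Lemma integrable_cons n (f : 'rV[R]_n.+1 -> R) : cc f ->
  (product_measure1 (@lebesgue_measure R) (lebesgue_rV n)).-integrable setT
    (EFin \o (f \o @cons_rV R n)).
Proof.
move=> ccf; have /integrableP[mf foo] := cc_integrable ccf.
apply/integrableP; split.
  exact: (measurableT_comp mf (@measurable_cons_rV R n)).
apply: le_lt_trans foo.
have := @ge0_integral_pushforward _ _ _ _ R _ (@measurable_cons_rV R n)
  ((@lebesgue_measure R) \x (lebesgue_rV n))%E setT (abse \o (EFin \o f)) measurableT.
move=> /= <- //; exact: measurableT_comp.
Qed.

Lemma integral_cons n (f : 'rV[R]_n.+1 -> R) : cc f ->
  (\int[lebesgue_rV n.+1]_x (f x)%:E =
   \int[((@lebesgue_measure R) \x (lebesgue_rV n))%E]_p (f (cons_rV p))%:E)%E.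
Proof.
move=> ccf; have /integrableP[mf foo] := cc_integrable ccf.
exact: (@integral_pushforward _ _ _ _ R _ (@measurable_cons_rV R n)
  ((@lebesgue_measure R) \x (lebesgue_rV n))%E setT (EFin \o f) mf
  (integrable_cons ccf) measurableT).
Qed.

Lemma integral_cons12 n (f : 'rV[R]_n.+1 -> R) : cc f ->
  (\int[lebesgue_rV n.+1]_x (f x)%:E =
   \int[lebesgue_measure]_t \int[lebesgue_rV n]_v (f (cons_rV (t, v)))%:E)%E.
Proof.
move=> ccf; rewrite integral_cons//.
by rewrite -(integral12_prod_meas1 (integrable_cons ccf)).
Qed.

Lemma integral_cons21 n (f : 'rV[R]_n.+1 -> R) : cc f ->
  (\int[lebesgue_rV n.+1]_x (f x)%:E =
   \int[lebesgue_rV n]_v \int[lebesgue_measure]_t (f (cons_rV (t, v)))%:E)%E.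
Proof.
move=> ccf; rewrite integral_cons//.
by rewrite -(integral21_prod_meas1 (integrable_cons ccf)).
Qed.

Lemma cc_cons n (f : 'rV[R]_n.+1 -> R) t : cc f -> cc (fun v => f (cons_rV (t, v))).
Proof.
move=> [cf [M fM]]; split.
  move=> v; apply: (@continuous_comp _ _ _ (fun w => cons_rV (t, w)) f); last exact: cf.
  apply: continuous_at_rV => i; case: (unliftP ord0 i) => [j ->|->].
    rewrite (_ : (fun _ => _) = (fun w : 'rV[R]_n => w ord0 j)).
      exact: coord_continuous.
    by apply/funext => w; rewrite mxE liftK.
  rewrite (_ : (fun _ => _) = (fun=> t)); first exact: cst_continuous.
  by apply/funext => w; rewrite mxE unlift_none.
by exists M => v Mv; apply: fM; rewrite (lt_le_trans Mv)// norm_cons_rV_ge.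
Qed.

Lemma cons_rV_delta0 n t (v : 'rV[R]_n) :
  cons_rV (t, v) = cons_rV (0, v) + t *: delta_mx ord0 ord0.
Proof.
apply/rowP => i; rewrite !mxE /=; case: unliftP => [j ->|->] /=.
  by rewrite mulr0 addr0.
by rewrite mulr1 add0r.
Qed.

Lemma cons_rV_delta_lift n t (v : 'rV[R]_n) s i :
  cons_rV (t, v + s *: delta_mx ord0 i) =
  cons_rV (t, v) + s *: delta_mx ord0 (lift ord0 i).
Proof.
apply/rowP => k; rewrite !mxE /=; case: unliftP => [j ->|->] /=.
  by rewrite !mxE eqxx /= (inj_eq lift_inj).
by rewrite mulr0 addr0.
Qed.

(** Fubini's theorem along an arbitrary coordinate.  The measure splits off the
    coordinate 0 only; the other ones are reached by induction on the dimension,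
    peeling off coordinate 0 and using the statement for the slices. *)
Lemma integral0_lines n (i : 'I_n) (f : 'rV[R]_n -> R) : cc f ->
  (forall x, \int[lebesgue_measure]_s (f (x + s *: delta_mx ord0 i))%:E = 0)%E ->
  (\int[lebesgue_rV n]_x (f x)%:E = 0)%E.
Proof.
elim: n => [|n IHn] in i f *; first by case: i.
move=> ccf f0; case: (unliftP ord0 i) => [k ik|i0].
  rewrite integral_cons12//; apply: integral0_eq => t _.
  apply: (IHn k); first exact: cc_cons.
  move=> x; rewrite -[RHS](f0 (cons_rV (t, x))).
  by apply: eq_integral => s _; rewrite cons_rV_delta_lift ik.
rewrite integral_cons21//; apply: integral0_eq => v _.
rewrite -[RHS](f0 (cons_rV (0, v))).
by apply: eq_integral => s _; rewrite cons_rV_delta0 i0.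
Qed.

Lemma integral_line_derive (g dg : R -> R) (M : R) :
  (forall t, M < `|t| -> g t = 0) -> (forall t, M < `|t| -> dg t = 0) ->
  (forall t : R, is_derive t (1 : R) g (dg t)) -> continuous dg ->
  (\int[lebesgue_measure]_t (dg t)%:E = 0)%E.
Proof.
move=> gM dgM g' cdg; pose N := `|M| + 1.
have MN : M < N by rewrite /N (le_lt_trans (ler_norm _))// ltrDl.
have N0 : 0 < N by rewrite /N ltr_pwDr.
have cg : continuous g.
  by move=> x; apply/differentiable_continuous/derivable1_diffP; apply: ex_derive.
rewrite (_ : (fun t => (dg t)%:E) = (EFin \o dg) \_ `[- N, N]); last first.
  apply/funext => t; rewrite patchE; case: ifPn => // /negP tN /=.
  rewrite dgM// ltNge; apply/negP => tM; apply: tN; apply/mem_set => /=.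
  by rewrite in_itv/= -ler_norml (le_trans tM)// ltW.
rewrite -integral_mkcond.
rewrite (@continuous_FTC2 _ dg g); first by
  rewrite !gM ?subee// ?normrN gtr0_norm.
- lra.
- exact: continuous_subspaceT.
- split.
  + by move=> x _; exact: ex_derive.
  + by apply: cvg_at_right_filter; exact: cg.
  + by apply: cvg_at_left_filter; exact: cg.
- by move=> x _; rewrite derive1E; exact: derive_val.
Qed.

End compactly_supported.

Local Notation cc := compactly_supported.

(** * Integration by parts along a coordinate direction *)

Section line.
Context {R : realType}.

(** A directional derivative is the derivative of a function of one real
    variable; this is how one-dimensional calculus is applied to functions
    that are only known to have partial derivatives. *)
Lemma is_derive_line (V : normedModType R) (f : V -> R) (x v : V) (r l : R) :
  is_derive (x + r *: v) v f l <->
  is_derive r (1 : R) (fun s : R => f (x + s *: v)) l.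
Proof.
have E : (fun h : R => h^-1 *: ((f \o shift (x + r *: v)) (h *: v) - f (x + r *: v))) =
  (fun h : R => h^-1 *: (((fun s : R => f (x + s *: v)) \o shift r) (h *: (1 : R))
      - f (x + r *: v))).
  apply/funext => h /=; congr (_ *: (f _ - _)).
  by rewrite scalerDl addrCA -[h%:A]mulr1 [h%:A * _]mulr1 [h%:A]mulr1.
split => -[d e]; constructor.
- by move: d; rewrite /derivable E.
- by move: e; rewrite /derive E.
- by move: d; rewrite /derivable -E.
- by move: e; rewrite /derive -E.
Qed.

Lemma is_derive_line0 (V : normedModType R) (f : V -> R) (x v : V) (l : R) :
  is_derive x v f l <->
  is_derive (0 : R) (1 : R) (fun s : R => f (x + s *: v)) l.
Proof. by rewrite -is_derive_line scale0r addr0. Qed.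

Lemma coord_line_norm n (x : 'rV[R]_n) i s :
  `|s| <= `|x + s *: delta_mx ord0 i| + `|x|.
Proof.
have -> : s = (x + s *: delta_mx ord0 i) ord0 i - x ord0 i.
  by rewrite !mxE !eqxx /= mulr1; ring.
rewrite (le_trans (ler_normB _ _))//.
have -> : (x + s *: delta_mx ord0 i) ord0 i - x ord0 i = s.
  by rewrite !mxE !eqxx /= mulr1; ring.
by rewrite lerD// coord_le_norm.
Qed.

Lemma continuous_line (V : normedModType R) (x v : V) :
  continuous (fun s : R => x + s *: v).
Proof.
move=> s; apply: cvgD; first exact: cvg_cst.
exact: scalel_continuous.
Qed.

(** The integral over each line in direction [i] is the integral of the
    derivative of a compactly supported function. *)
Lemma integral_partial n (i : 'I_n) (X X1 : 'rV[R]_n -> R) : cc X -> cc X1 ->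
  (forall x, is_derive x (delta_mx ord0 i) X (X1 x)) ->
  (\int[lebesgue_rV n]_x (X1 x)%:E = 0)%E.
Proof.
move=> [cX [M XM]] ccX1 X'; have [cX1 [M1 X1M]] := ccX1.
apply: (@integral0_lines _ _ i) => // x.
(* Along a line, points with a large parameter have a large norm. *)
have far A s : `|M| + `|M1| + `|x| < `|s| -> `|A| <= `|M| + `|M1| ->
    A < `|x + s *: delta_mx ord0 i|.
  move=> h hA; have := coord_line_norm x i s.
  have := ler_norm A; lra.
apply: (@integral_line_derive _ (fun s => X (x + s *: delta_mx ord0 i)) _
   (`|M| + `|M1| + `|x|)) => [t tM|t tM|t|].
- by apply: XM; apply: far; rewrite // lerDl.
- by apply: X1M; apply: far; rewrite // lerDr.
- exact: (iffLR (@is_derive_line _ X x _ t _) (X' _)).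
- move=> s; apply: (@continuous_comp _ _ _ (fun s : R => x + s *: delta_mx ord0 i) X1).
    exact: continuous_line.
  exact: cX1.
Qed.

(** Outside of the closed set [S] the function vanishes near every point, so
    regularity has to be checked on [O] only.  The functions below are
    quotients by a function that is positive on [O] and arbitrary elsewhere. *)
Lemma cc_patch (V : normedModType R) (S O : set V) (f : V -> R) :
  closed S -> bounded_set S -> S `<=` O ->
  (forall x, O x -> {for x, continuous f}) ->
  (forall x, ~ S x -> f x = 0) -> cc f.
Proof.
move=> cS [M [_ bS]] SO cf f0; split.
  move=> x; have [Sx|nSx] := pselect (S x); first exact/cf/SO.
  have : \forall y \near x, 0 = f y.
    have : open_nbhs x (~` S) by split=> //; exact: closed_openC.
    by move=> /open_nbhs_nbhs; apply: filterS => y /f0.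
  move=> h; rewrite /continuous_at f0//; apply: cvg_trans (@cvg_cst _ (0 : R) _ (nbhs x) _).
  by apply: near_eq_cvg; exact: h.
exists (M + 1) => x Mx; apply: f0 => /(bS (M + 1)).
by rewrite ltrDl => /(_ ltr01) /=; rewrite leNgt Mx.
Qed.

Lemma is_derive_patch (V : normedModType R) (S O : set V) (v : V) (f f1 : V -> R) :
  closed S -> S `<=` O ->
  (forall x, O x -> is_derive x v f (f1 x)) ->
  (forall x, ~ S x -> f x = 0) -> (forall x, ~ S x -> f1 x = 0) ->
  forall x, is_derive x v f (f1 x).
Proof.
move=> cS SO f' f0 f10 x; have [Sx|nSx] := pselect (S x); first exact/f'/SO.
have : \forall y \near x, cst 0 y = f y.
  have : open_nbhs x (~` S) by split=> //; exact: closed_openC.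
  by move=> /open_nbhs_nbhs; apply: filterS => y /f0.
move=> h; rewrite f10//; exact: (near_eq_is_derive h (is_derive_cst (0 : R) x v)).
Qed.

Lemma integral_partial_patch n (i : 'I_n) (S O : set 'rV[R]_n) (X X1 : 'rV[R]_n -> R) :
  closed S -> bounded_set S -> S `<=` O ->
  (forall x, O x -> {for x, continuous X}) ->
  (forall x, O x -> {for x, continuous X1}) ->
  (forall x, O x -> is_derive x (delta_mx ord0 i) X (X1 x)) ->
  (forall x, ~ S x -> X x = 0) -> (forall x, ~ S x -> X1 x = 0) ->
  (\int[lebesgue_rV n]_x X1 x = 0).
Proof.
move=> cS bS SO cX cX1 X' X0 X10.
have ccX := cc_patch cS bS SO cX X0.
have ccX1 := cc_patch cS bS SO cX1 X10.
have dX := is_derive_patch cS SO X' X0 X10.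
by rewrite /Rintegral (integral_partial ccX ccX1 dX).
Qed.

End line.

(** * Picone's inequality *)

(** The continuity and differentiation rules are restated for functions given
    by an explicit expression of their argument, as opposed to operations on
    functions. *)
Section continuity.
Context {R : realType} {T : topologicalType}.
Implicit Types (f g : T -> R) (x : T).

Lemma cont_cst (a : R) x : {for x, continuous (fun _ : T => a)}.
Proof. exact: cvg_cst. Qed.

Lemma cont_add f g x : {for x, continuous f} -> {for x, continuous g} ->
  {for x, continuous (fun y => f y + g y)}.
Proof. exact: cvgD. Qed.

Lemma cont_sum (I : Type) (r : seq I) (P : pred I) (F : I -> T -> R) x :
  (forall i, P i -> {for x, continuous (F i)}) ->
  {for x, continuous (fun y => \sum_(i <- r | P i) F i y)}.
Proof.
move=> cF; elim: r => [|i r IH].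
  rewrite (_ : (fun y => _) = fun=> 0); first exact: cont_cst.
  by apply/funext => y; rewrite big_nil.
have [Pi|nPi] := boolP (P i).
  rewrite (_ : (fun y => _) = fun y => F i y + \sum_(i <- r | P i) F i y).
    by apply: cont_add => //; exact: cF.
  by apply/funext => y; rewrite big_cons Pi.
rewrite (_ : (fun y => _) = fun y => \sum_(i <- r | P i) F i y)//.
by apply/funext => y; rewrite big_cons (negbTE nPi).
Qed.

Lemma cont_mul f g x : {for x, continuous f} -> {for x, continuous g} ->
  {for x, continuous (fun y => f y * g y)}.
Proof. exact: cvgM. Qed.

Lemma cont_sqr f x : {for x, continuous f} -> {for x, continuous (fun y => f y ^+ 2)}.
Proof. by move=> cf; rewrite (_ : (fun _ => _) = fun y => f y * f y)//; exact: cvgM. Qed.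

Lemma cont_opp f x : {for x, continuous f} -> {for x, continuous (fun y => - f y)}.
Proof. exact: cvgN. Qed.

Lemma cont_inv f x : f x != 0 -> {for x, continuous f} ->
  {for x, continuous (fun y => (f y)^-1)}.
Proof. exact: cvgV. Qed.

End continuity.

Section calculus.
Context {R : realType} {V : normedModType R}.
Implicit Types (f g : V -> R) (x v : V).

Lemma is_derive_mul f g x v a b : is_derive x v f a -> is_derive x v g b ->
  is_derive x v (fun y => f y * g y) (f x * b + a * g x).
Proof.
move=> df dg; have h : is_derive x v (fun y => f y * g y) _ := is_deriveM df dg.
by apply: is_derive_eq; rewrite /GRing.scale /=; ring.
Qed.

Lemma is_derive_inv f x v a : f x != 0 -> is_derive x v f a ->
  is_derive x v (fun y => (f y)^-1) (- a / f x ^+ 2).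
Proof.
move=> fx [df <-]; constructor; first exact: derivableV.
by rewrite deriveV//= /GRing.scale /=; field.
Qed.

Lemma is_derive_chain (F : R -> R) f x v a b :
  is_derive (f x) (1 : R) F a -> is_derive x v f b ->
  is_derive x v (fun y => F (f y)) (a * b).
Proof.
move=> dF /is_derive_line0 df; apply/is_derive_line0.
apply: (@is_derive1_comp _ F (fun s : R => f (x + s *: v))) => //.
by rewrite scale0r addr0.
Qed.

End calculus.

Section picone.
Context {R : realType}.

Lemma le_integral_cc n (f g : 'rV[R]_n -> R) : cc f -> cc g ->
  (forall x, f x <= g x) ->
  \int[lebesgue_rV n]_x f x <= \int[lebesgue_rV n]_x g x.
Proof.
move=> cf cg fg; apply: le_Rintegral => //; exact: cc_integrable.
Qed.

Variables (n : nat) (i : 'I_n) (S O : set 'rV[R]_n).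
Variables (w w1 U U1 U2 : 'rV[R]_n -> R).
Hypotheses (clS : closed S) (bdS : bounded_set S) (SO : S `<=` O).
Hypotheses (cw : forall x, O x -> {for x, continuous w})
  (cw1 : forall x, O x -> {for x, continuous w1})
  (cU : forall x, O x -> {for x, continuous U})
  (cU1 : forall x, O x -> {for x, continuous U1})
  (cU2 : forall x, O x -> {for x, continuous U2}).
Hypotheses (dw : forall x, O x -> is_derive x (delta_mx ord0 i) w (w1 x))
  (dU : forall x, O x -> is_derive x (delta_mx ord0 i) U (U1 x))
  (dU1 : forall x, O x -> is_derive x (delta_mx ord0 i) U1 (U2 x)).
Hypotheses (U0 : forall x, O x -> 0 < U x)
  (w0 : forall x, ~ S x -> w x = 0) (w10 : forall x, ~ S x -> w1 x = 0).

Lemma cc_picone : cc (fun x => w1 x ^+ 2 + U2 x / U x * w x ^+ 2).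
Proof.
apply: cc_patch clS bdS SO _ _ => x Ox; last by rewrite w0// w10// expr0n/= mulr0 addr0.
have Ux : U x != 0 by rewrite gt_eqF// U0.
apply: cont_add; first exact/cont_sqr/cw1.
by apply: cont_mul; [apply: cont_mul; [exact: cU2|exact/cont_inv/cU]|exact/cont_sqr/cw].
Qed.

(** The integrand is the sum of the partial derivative of [w ^ 2 * U1 / U],
    whose integral vanishes, and of the square of [w1 - w * U1 / U]. *)
Lemma picone : 0 <= \int[lebesgue_rV n]_x (w1 x ^+ 2 + U2 x / U x * w x ^+ 2).
Proof.
pose X x := (w x * w x) * (U1 x * (U x)^-1).
pose X1 x := (w x * w x) * (U1 x * (- U1 x / U x ^+ 2) + U2 x * (U x)^-1) +
  (w x * w1 x + w1 x * w x) * (U1 x * (U x)^-1).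
have UN0 x : O x -> U x != 0 by move=> Ox; rewrite gt_eqF// U0.
have cV x : O x -> {for x, continuous (fun y => (U y)^-1)}.
  by move=> Ox; apply: cont_inv; [exact: UN0|exact: cU].
have X10 x : ~ S x -> X1 x = 0 by move=> Sx; rewrite /X1 w0// w10//; ring.
have cX1 x : O x -> {for x, continuous X1}.
  move=> Ox; have Ux := UN0 _ Ox; apply: cont_add; apply: cont_mul.
  - by apply: cont_mul; exact: cw.
  - apply: cont_add; apply: cont_mul; [exact: cU1| |exact: cU2|exact: cV].
    apply: cont_mul; first exact/cont_opp/cU1.
    by apply: cont_inv; [rewrite expf_neq0|exact/cont_sqr/cU].
  - by apply: cont_add; apply: cont_mul; by [exact: cw|exact: cw1].
  - by apply: cont_mul; [exact: cU1|exact: cV].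
have IX1 : \int[lebesgue_rV n]_x X1 x = 0.
  apply: (@integral_partial_patch _ _ i S O X X1) => // x Ox.
  - apply: cont_mul; first by apply: cont_mul; exact: cw.
    by apply: cont_mul; [exact: cU1|exact: cV].
  - have Ux := UN0 _ Ox.
    apply: is_derive_mul; first by apply: is_derive_mul; exact: dw.
    apply: is_derive_mul; first exact: dU1.
    by apply: is_derive_inv => //; exact: dU.
  - by rewrite /X w0// !mul0r.
rewrite -[X in X <= _]IX1.
apply: le_integral_cc; [exact: cc_patch cX1 X10|exact: cc_picone|] => x.
have [Sx|nSx] := pselect (S x); last first.
  by rewrite X10// w0// w10// expr0n/= mulr0 addr0.
rewrite -subr_ge0 (_ : _ - _ = (w1 x - w x * U1 x / U x) ^+ 2) ?sqr_ge0//.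
by rewrite /X1; field; exact/UN0/SO.
Qed.

End picone.

(** * A continuously differentiable cutoff *)

Section cutoff.
Context {R : realType}.
Implicit Types (s t e a : R).

Definition pospart s : R := Num.max s 0.

Lemma pospart_ge0 s : 0 <= pospart s.
Proof. by rewrite /pospart le_max lexx orbT. Qed.

Lemma ger0_pospart s : 0 <= s -> pospart s = s.
Proof. by move=> s0; rewrite /pospart max_l. Qed.

Lemma ler0_pospart s : s <= 0 -> pospart s = 0.
Proof. by move=> s0; rewrite /pospart max_r. Qed.

Lemma cont_pospart s : {for s, continuous pospart}.
Proof.
apply: (@continuous_max _ R (fun x => x) (fun=> 0)); [exact: cvg_id|exact: cvg_cst].
Qed.

Lemma is_derive_pospart_sqr s :
  is_derive s (1 : R) (fun t => pospart t ^+ 2) (2 * pospart s).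
Proof.
have [s0|s0|->] := ltgtP s 0.
- have h : \forall t \near s, cst 0 t = pospart t ^+ 2.
    near=> t; rewrite ler0_pospart ?expr0n//.
    by apply: ltW; near: t; exact: lt_nbhsl.
  rewrite ler0_pospart ?mulr0; last exact: ltW.
  exact: (near_eq_is_derive h (is_derive_cst _ _ _)).
- have h : \forall t \near s, t * t = pospart t ^+ 2.
    near=> t; rewrite ger0_pospart ?expr2//.
    by apply: ltW; near: t; exact: lt_nbhsr.
  rewrite ger0_pospart; last exact: ltW.
  have d : is_derive s (1 : R) (fun t : R => t * t) (s * 1 + 1 * s).
    by apply: is_derive_mul; exact: is_derive_id.
  rewrite (_ : 2 * s = s * 1 + 1 * s); last by ring.
  exact: (near_eq_is_derive h d).
- have h : h^-1 *: (((fun t => pospart t ^+ 2) \o shift 0) (h *: (1 : R))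
      - (fun t => pospart t ^+ 2) 0) @[h --> (0 : R)^'] --> (0 : R).
    apply/cvgr0Pnorm_lt => e e0; near=> h => /=.
    have h0 : h != 0 by near: h; exact: nbhs_dnbhs_neq.
    rewrite (@ler0_pospart 0)// expr0n/= subr0 addr0 [h%:A]mulr1.
    rewrite normrM normfV ltr_pdivrMl ?normr_gt0// expr2 normrM.
    have ph : `|pospart h| <= `|h|.
      rewrite ger0_norm ?pospart_ge0// /pospart; case: (leP h 0) => // _.
      exact: ler_norm.
    apply: le_lt_trans (ler_wpM2r _ ph) _ => //.
    rewrite ltr_pM2l ?normr_gt0//; apply: le_lt_trans ph _.
    by near: h; exact: dnbhs0_lt.
  rewrite (@ler0_pospart 0)// mulr0; constructor; first by apply/cvg_ex; exists 0.
  exact: cvg_lim.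
Unshelve. all: by end_near. Qed.

(** The expression [(s - e) ^ 2 / s] beyond [e] is chosen for its derivative
    [1 - (e / s) ^ 2], which vanishes at [e], lies between 0 and 1 and increases
    to 1 as [e] decreases to 0. *)
Definition cutoff e s : R := pospart (s - e) ^+ 2 / s.

Definition cutoff1 e s : R :=
  2 * pospart (s - e) / s - pospart (s - e) ^+ 2 / s ^+ 2.

Lemma is_derive_cutoff e s : s != 0 -> is_derive s (1 : R) (cutoff e) (cutoff1 e s).
Proof.
move=> s0.
have d1 : is_derive s (1 : R) (fun t => t - e) 1.
  have h : is_derive s (1 : R) (fun t => t - e) _ :=
      is_deriveB (is_derive_id s 1) (is_derive_cst e s 1).
  by apply: is_derive_eq; rewrite subr0.
have d2 := @is_derive_chain _ _ _ (fun t => t - e) _ _ _ _ (is_derive_pospart_sqr (s - e)) d1.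
have d3 := @is_derive_inv _ _ id s _ _ s0 (is_derive_id s (1 : R)).
have d := is_derive_mul d2 d3.
by apply: (@is_derive_eq _ _ _ _ _ _ _ _ d); rewrite /cutoff1; field.
Qed.

Lemma cont_cutoffarg e s : {for s, continuous (fun t => pospart (t - e))}.
Proof.
apply: continuous_comp; last exact: cont_pospart.
by apply: cont_add; [exact: cvg_id|exact: cvg_cst].
Qed.

Lemma cont_cutoff e s : s != 0 -> {for s, continuous (cutoff e)}.
Proof.
move=> s0; apply: cont_mul; first exact/cont_sqr/cont_cutoffarg.
by apply: cont_inv => //; exact: cvg_id.
Qed.

Lemma cont_cutoff1 e s : s != 0 -> {for s, continuous (cutoff1 e)}.
Proof.
move=> s0; apply: cont_add.
  apply: cont_mul; first by apply: cont_mul; [exact: cvg_cst|exact: cont_cutoffarg].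
  by apply: cont_inv => //; exact: cvg_id.
apply: cont_opp; apply: cont_mul; first exact/cont_sqr/cont_cutoffarg.
by apply: cont_inv; [rewrite expf_neq0|apply: cont_sqr; exact: cvg_id].
Qed.

Lemma cutoff_eq0 e s : s <= e -> cutoff e s = 0.
Proof. by move=> se; rewrite /cutoff ler0_pospart ?subr_le0// expr0n/= mul0r. Qed.

Lemma cutoff1_eq0 e s : s <= e -> cutoff1 e s = 0.
Proof.
by move=> se; rewrite /cutoff1 ler0_pospart ?subr_le0// expr0n/= mulr0 !mul0r subr0.
Qed.

Lemma cutoff1E e s : 0 < e -> e <= s -> cutoff1 e s = 1 - (e / s) ^+ 2.
Proof.
move=> e0 es; rewrite /cutoff1 ger0_pospart ?subr_ge0//.
by field; rewrite gt_eqF// (lt_le_trans e0).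
Qed.

Lemma cutoffE e s : 0 < e -> e <= s -> cutoff e s = s - 2 * e + e ^+ 2 / s.
Proof.
move=> e0 es; rewrite /cutoff ger0_pospart ?subr_ge0//.
by field; rewrite gt_eqF// (lt_le_trans e0).
Qed.

Lemma cutoff1_ge0 e s : 0 < e -> 0 <= cutoff1 e s.
Proof.
move=> e0; have [se|es] := leP s e; first by rewrite cutoff1_eq0.
have s0 : 0 < s by rewrite (lt_trans e0).
by rewrite (cutoff1E e0 (ltW es)) subr_ge0 expr_le1 ?divr_ge0 ?(ltW e0)
  ?(ltW s0)// ler_pdivrMr ?mul1r ?(ltW es).
Qed.

Lemma cutoff1_le1 e s : 0 < e -> cutoff1 e s <= 1.
Proof.
move=> e0; have [se|es] := leP s e; first by rewrite cutoff1_eq0.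
by rewrite (cutoff1E e0 (ltW es)) gerBl sqr_ge0.
Qed.

Lemma cutoff_ge0 e s : 0 <= s -> 0 <= cutoff e s.
Proof. by move=> s0; rewrite /cutoff divr_ge0 ?sqr_ge0. Qed.

Lemma cutoff_le e s : 0 < e -> 0 <= s -> cutoff e s <= s.
Proof.
move=> e0 s0; have [se|es] := leP s e; first by rewrite cutoff_eq0.
have {}s0 : 0 < s by rewrite (lt_trans e0).
rewrite /cutoff ler_pdivrMr// ger0_pospart ?subr_ge0 ?(ltW es)//; nra.
Qed.

Lemma cutoff_ge e s : 0 < e -> 0 <= s -> s - 2 * e <= cutoff e s.
Proof.
move=> e0 s0; have [se|es] := leP s e; first by rewrite cutoff_eq0//; lra.
have {}s0 : 0 < s by rewrite (lt_trans e0).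
by rewrite (cutoffE e0 (ltW es)) lerDl divr_ge0 ?sqr_ge0 ?(ltW s0).
Qed.

Lemma cutoff1_nincr e e' s : 0 < e -> e <= e' -> cutoff1 e' s <= cutoff1 e s.
Proof.
move=> e0 ee'; have e'0 := lt_le_trans e0 ee'.
have [se'|e's] := leP s e'; first by rewrite cutoff1_eq0// cutoff1_ge0.
have s0 : 0 < s by rewrite (lt_trans e'0).
rewrite (cutoff1E e'0 (ltW e's)) (cutoff1E e0 (le_trans ee' (ltW e's))) lerD2l lerN2.
rewrite ler_pXn2r// ?nnegrE ?divr_ge0 ?(ltW e0) ?(ltW e'0) ?(ltW s0)//.
by rewrite ler_pM2r// invr_gt0.
Qed.

Lemma cutoff1_cvg s : 0 < s -> cutoff1 k.+1%:R^-1 s @[k --> \oo] --> (1 : R).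
Proof.
move=> s0.
have h : 1 - (k.+1%:R^-1 / s) ^+ 2 @[k --> \oo] --> (1 - (0 / s) ^+ 2 : R).
  apply: cvgB; first exact: cvg_cst.
  have h : k.+1%:R^-1 / s @[k --> \oo] --> (0 / s : R).
    by apply: cvgM; [exact: cvg_harmonic|exact: cvg_cst].
  rewrite expr2; under eq_cvg do rewrite expr2; exact: cvgM.
rewrite mul0r expr0n/= subr0 in h.
apply: cvg_trans h; apply: near_eq_cvg; near=> k.
rewrite cutoff1E//; near: k; apply: filterS (near_infty_natSinv_lt (PosNum s0)) => k /=.
exact: ltW.
Unshelve. all: by end_near. Qed.

End cutoff.

(** * An upper bound for the eigenvalue by the maximum principle *)

Section max_principle.
Context {R : realType}.

(** The first derivative vanishes at 0; were the second one positive, the first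
    would be positive just after 0 and the function would increase there. *)
Lemma second_derivative_at_max (g g1 : R -> R) (g2 e : R) : 0 < e ->
  (forall t : R, `|t| < e -> is_derive t (1 : R) g (g1 t)) ->
  is_derive (0 : R) (1 : R) g1 g2 ->
  (forall t, `|t| < e -> g t <= g 0) -> g2 <= 0.
Proof.
move=> e0 g' g'' gmax.
have in_e t : t \in `](- e), e[ -> `|t| < e by rewrite in_itv/= ltr_norml.
have g10 : g1 0 = 0.
  have d0 : is_derive (0 : R) (1 : R) g 0.
    apply: (@derive1_at_max _ g (- e) e) => [|t /in_e te||t /in_e te].
    - lra.
    - by have [] := g' t te.
    - by rewrite in_itv/= oppr_lt0 e0.
    - exact: gmax.
  have d1 := g' 0 ltac:(by rewrite normr0).
  by rewrite -(@derive_val _ _ _ _ _ _ _ d1) (@derive_val _ _ _ _ _ _ _ d0).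
rewrite leNgt; apply/negP => g20.
have [d dv] := g''.
have lim : h^-1 *: ((g1 \o shift 0) (h *: (1 : R)) - g1 0) @[h --> (0 : R)^'] --> g2.
  by move: d; rewrite /derivable => /cvg_ex[l hl]; move: dv;
     rewrite /derive => <-; apply/cvg_ex; exists l.
have [r /= r0 hr] : \forall h \near (0 : R)^',
    0 < h^-1 *: ((g1 \o shift 0) (h *: (1 : R)) - g1 0).
  exact: cvgr_gt lim _ g20.
have g1pos h : 0 < h -> h < r -> 0 < g1 h.
  move=> h0 hlt; have := hr h; rewrite /= sub0r normrN gtr0_norm// => /(_ hlt).
  rewrite gt_eqF// => /(_ isT); rewrite g10 subr0 addr0 [h%:A]mulr1.
  by rewrite pmulr_rgt0 // invr_gt0.
pose h := Num.min r e / 2.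
have m0 : 0 < Num.min r e by rewrite lt_min r0.
have h0 : 0 < h by rewrite divr_gt0.
have [hr' he] : h < r /\ h < e.
  have : h < Num.min r e by rewrite /h; lra.
  by rewrite lt_min => /andP[].
have ne t : 0 <= t -> t <= h -> `|t| < e.
  by move=> t0 th; rewrite ger0_norm// (le_lt_trans th).
have hd t : t \in `]0, h[ -> is_derive t (1 : R) g (g1 t).
  by rewrite in_itv/= => /andP[t0 th]; apply: g'; apply: ne; exact: ltW.
have hc : {within `[0, h], continuous g}.
  apply: continuous_in_subspaceT => t; rewrite inE/= in_itv/= => /andP[t0 th].
  have [dt _] := g' t (ne t t0 th).
  exact/differentiable_continuous/derivable1_diffP.
have [c + E] := MVT h0 hd hc; rewrite in_itv/= => /andP[c0 ch].
have := gmax h (ne h (ltW h0) (lexx _)).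
by rewrite -subr_le0 E subr0 leNgt mulr_gt0// g1pos// (lt_trans ch).
Qed.


Lemma is_derive_quadratic (a b c t : R) :
  is_derive t (1 : R) (fun s : R => a + b * s + c * s ^+ 2) (b + 2 * c * t).
Proof.
have d1 := is_derive_mul (is_derive_cst b t 1) (is_derive_id t (1 : R)).
have d2 := is_derive_mul (is_derive_id t (1 : R)) (is_derive_id t (1 : R)).
have d3 := is_derive_mul (is_derive_cst c t 1) d2.
have d : is_derive t (1 : R) (fun s : R => a + b * s + c * s ^+ 2) _ :=
  is_deriveD (is_deriveD (is_derive_cst a t 1) d1) d3.
by apply: is_derive_eq; rewrite /=; ring.
Qed.

(** The restriction to a coordinate line of a squared distance is a quadratic
    polynomial of the parameter. *)
Lemma sum_sqr_line n (x c : 'rV[R]_n) i t :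
  \sum_j ((x + t *: delta_mx ord0 i) ord0 j - c ord0 j) ^+ 2 =
  \sum_j (x ord0 j - c ord0 j) ^+ 2 + t * (2 * (x ord0 i - c ord0 i) + t).
Proof.
rewrite (bigD1 i)//= [in RHS](bigD1 i)//= !mxE !eqxx /= mulr1.
rewrite (eq_bigr (fun j => (x ord0 j - c ord0 j) ^+ 2)); first by ring.
by move=> j ji; rewrite !mxE (negbTE ji) andbF mulr0 addr0.
Qed.

(** At a point [x0] of the ball where [q ^ 2 / u] is maximal, with
    [q = 1 - |x - c|^2 / rho^2], the function [q ^ 2 - m * u] has a local
    maximum, [m] being the maximal value.  Its Laplacian is thus nonpositive,
    which with [m * u = q ^ 2] at [x0] reads
    [lambda * Q ^ 2 <= ((4 * n + 8) * Q - 8) / rho ^ 2] for [Q = q x0].  The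
    square in [q ^ 2] is what keeps the right-hand side harmless for small [Q]. *)
Lemma eigenvalue_ball_bound n (Om : set 'rV[R]_n) (u : 'rV[R]_n -> R)
    (lambda rho : R) (c : 'rV[R]_n) :
  C2_on Om u -> (forall x, Om x -> {for x, continuous u}) ->
  (forall x, Om x -> laplacian u x + lambda * u x = 0) ->
  (forall x, Om x -> 0 < u x) -> 0 < rho ->
  [set x : 'rV[R]_n | \sum_i (x ord0 i - c ord0 i) ^+ 2 <= rho ^+ 2] `<=` Om ->
  lambda <= (n.+2%:R / rho) ^+ 2 / 2.
Proof.
move=> [C1u C2u] cu eqn u0 rho0 BO.
pose q (x : 'rV[R]_n) := 1 - (\sum_i (x ord0 i - c ord0 i) ^+ 2) / rho ^+ 2.
have rho2 : 0 < rho ^+ 2 by rewrite exprn_gt0.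
pose A := [set x | 0 <= q x].
have AO : A `<=` Om.
  move=> x; rewrite /A /q /= subr_ge0 ler_pdivrMr// mul1r => h; exact: BO.
have cq : continuous q.
  suff : forall x, {for x, continuous q} by [].
  move=> x; apply: cont_add; first exact: cont_cst.
  apply: cont_opp; apply: cont_mul; last exact: cont_cst.
  apply: cont_sum => i _.
  by apply: cont_sqr; apply: cont_add; [exact: coord_continuous|exact: cont_cst].
have clA : closed A.
  rewrite (_ : A = [set x | - q x <= 0]); last first.
    by apply/seteqP; split => x; rewrite /A /= oppr_le0.
  by apply: closed_sublevel => x; exact/cont_opp/cq.
have bdA : bounded_set A.
  exists (rho + `|c|); split; first exact: num_real.
  move=> M hM x; rewrite /A /q /= subr_ge0 ler_pdivrMr// mul1r => hx.
  have : `|x - c| < rho + (M - (rho + `|c|)).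
    apply: norm_lt_coord => [|i]; first lra.
    rewrite !mxE; apply: (@le_lt_trans _ _ rho); last lra.
    rewrite -(@ler_pXn2r _ 2)// ?nnegrE ?(ltW rho0)// real_normK ?num_real//.
    apply: le_trans hx; rewrite (bigD1 i)//= lerDl; apply: sumr_ge0 => *.
    exact: sqr_ge0.
  by have := ler_normD (x - c) c; rewrite subrK; lra.
have qc : q c = 1.
  by rewrite /q big1 ?mul0r ?subr0// => i _; rewrite subrr expr0n.
have Ac : A c by rewrite /A /= qc.
pose g x := q x ^+ 2 / u x.
have cg : {within A, continuous g}.
  apply: continuous_in_subspaceT => x; rewrite inE => Ax.
  have Ox := AO _ Ax; suff : {for x, continuous g} by [].
  apply: cont_mul; first exact/cont_sqr/cq.
  by apply: cont_inv; [rewrite gt_eqF// u0|exact: cu].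
have [x0 + gmax] := @compact_EVT_max _ R g A (ex_intro _ c Ac)
  (bounded_closed_compact bdA clA) cg.
rewrite inE => Ax0; set m := g x0.
have Ox0 := AO _ Ax0; have ux0 := u0 _ Ox0.
have m0 : 0 < m.
  apply: lt_le_trans (gmax c (mem_set Ac)).
  by rewrite /g qc expr1n div1r invr_gt0 u0//; exact: AO.
have qx0 : 0 < q x0.
  rewrite lt_def Ax0 andbT; apply: contraTneq m0 => q0.
  by rewrite /m /g q0 expr0n/= mul0r ltxx.
have mu : m * u x0 = q x0 ^+ 2 by rewrite /m /g divfK// gt_eqF.
pose z i := x0 ord0 i - c ord0 i.
have step i : 8 * z i ^+ 2 / rho ^+ 4 - 4 * q x0 / rho ^+ 2
    - m * partial i (partial i u) x0 <= 0.
  pose b := - (2 * z i) / rho ^+ 2.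
  pose b2 := - 1 / rho ^+ 2.
  pose P t := q x0 + b * t + b2 * t ^+ 2.
  pose P1 t := b + 2 * b2 * t.
  have Pq t : q (x0 + t *: delta_mx ord0 i) = P t.
    by rewrite /q /P sum_sqr_line /q /b /b2 /z; ring.
  have [e e0 he] : exists2 e, 0 < e & forall t, `|t| < e ->
      A (x0 + t *: delta_mx ord0 i).
    have cl : {for (0 : R), continuous (fun t : R => q (x0 + t *: delta_mx ord0 i))}.
      apply: (@continuous_comp _ _ _ (fun t : R => x0 + t *: delta_mx ord0 i) q).
        exact: continuous_line.
      exact: cq.
    have := @cvgr_gt _ _ _ _ _ _ cl 0; rewrite scale0r addr0 => /(_ _ qx0).
    move=> [e e0 he]; exists e => // t te; apply/ltW/he => /=.
    by rewrite sub0r normrN.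
  have dP t : is_derive t (1 : R) P (P1 t).
    have -> : P1 t = b + 2 * b2 * t by [].
    exact: is_derive_quadratic.
  have dP1 t : is_derive t (1 : R) P1 (2 * b2).
    have -> : P1 = fun s => b + 2 * b2 * s + 0 * s ^+ 2.
      by apply/funext => s; rewrite mul0r addr0.
    have := is_derive_quadratic b (2 * b2) 0 t.
    by rewrite mulr0 mul0r addr0.
  pose ul (f : 'rV[R]_n -> R) t := f (x0 + t *: delta_mx ord0 i).
  have du t : `|t| < e -> is_derive t (1 : R) (ul u) (ul (partial i u) t).
    move=> te; apply: (iffLR (@is_derive_line _ _ u x0 _ t _)).
    by have [d _] := C1u i _ (AO _ (he t te)); exact: derivableP.
  have du1 t : `|t| < e ->
      is_derive t (1 : R) (ul (partial i u)) (ul (partial i (partial i u)) t).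
    move=> te; apply: (iffLR (@is_derive_line _ _ (partial i u) x0 _ t _)).
    by have [d _] := C2u i i _ (AO _ (he t te)); exact: derivableP.
  pose h t := P t * P t - m * ul u t.
  pose h1 t := (P t * P1 t + P1 t * P t) - (m * ul (partial i u) t + 0 * ul u t).
  have e00 : `|0 : R| < e by rewrite normr0.
  have E : 8 * z i ^+ 2 / rho ^+ 4 - 4 * q x0 / rho ^+ 2
      - m * partial i (partial i u) x0 =
    (P 0 * (2 * b2) + P1 0 * P1 0 + (P1 0 * P1 0 + 2 * b2 * P 0))
    - (m * ul (partial i (partial i u)) 0 + 0 * ul (partial i u) 0).
    rewrite /P /P1 /ul !scale0r !addr0 !mul0r !mulr0 !addr0 expr0n /= mulr0 !addr0 /b /b2.
    by field; rewrite gt_eqF.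
  have dh t : `|t| < e -> is_derive t (1 : R) h (h1 t).
    move=> te; exact: (is_deriveB (is_derive_mul (dP t) (dP t))
      (is_derive_mul (is_derive_cst m t (1 : R)) (du t te))).
  have dh1 : is_derive (0 : R) (1 : R) h1
    ((P 0 * (2 * b2) + P1 0 * P1 0 + (P1 0 * P1 0 + 2 * b2 * P 0))
    - (m * ul (partial i (partial i u)) 0 + 0 * ul (partial i u) 0)).
    have d1 := is_deriveD (is_derive_mul (dP 0) (dP1 0)) (is_derive_mul (dP1 0) (dP 0)).
    have d2 := is_derive_mul (is_derive_cst m (0 : R) (1 : R)) (du1 0 e00).
    rewrite (_ : h1 = (fun y => P y * P1 y) + (fun y => P1 y * P y) -
      (fun y => cst m y * ul (partial i u) y)); first exact: (is_deriveB d1 d2).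
    by apply/funext => y; rewrite /h1 mul0r addr0.
  have hmax t : `|t| < e -> h t <= h 0.
    move=> te.
    have ht : q (x0 + t *: delta_mx ord0 i) ^+ 2 <= m * ul u t.
      have At := he t te; rewrite -ler_pdivrMr; last exact/u0/AO.
      exact: (gmax _ (mem_set At)).
    have -> : h 0 = 0.
      by rewrite /h /P /ul !scale0r !addr0 expr0n /= !mulr0 !addr0 mu; ring.
    by rewrite /h -expr2 -Pq subr_le0.
  rewrite E; exact: (second_derivative_at_max e0 dh dh1 hmax).
have : \sum_i (8 * z i ^+ 2 / rho ^+ 4 - 4 * q x0 / rho ^+ 2
    - m * partial i (partial i u) x0) <= 0 by apply: sumr_le0.
rewrite big_split /= big_split /= !sumrN -[X in _ - X <= _]mulr_sumr.
rewrite -/(laplacian u x0).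
have -> : laplacian u x0 = - (lambda * u x0).
  by apply/eqP; rewrite -addr_eq0 eqn.
rewrite sumr_const card_ord.
have -> : \sum_i 8 * z i ^+ 2 / rho ^+ 4 = 8 * (1 - q x0) / rho ^+ 2.
  rewrite /q opprB addrCA subrr addr0.
  rewrite (eq_bigr (fun i => 8 / rho ^+ 4 * z i ^+ 2)) => [|i _]; last by ring.
  by rewrite -mulr_sumr; field; rewrite gt_eqF.
rewrite mulrN opprK mulrCA mu -(mulr_natl _ n).
have -> : n.+2%:R = n%:R + 2 :> R by rewrite -addn2 natrD.
set Q := q x0 in qx0 *; move: (n%:R : R) => N H0.
have {}H0 : lambda * Q ^+ 2 - ((4 * N + 8) * Q - 8) / rho ^+ 2 <= 0.
  by apply: le_trans H0; rewrite le_eqVlt; apply/orP; left; apply/eqP; ring.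
have H : lambda * Q ^+ 2 <= ((4 * N + 8) * Q - 8) / rho ^+ 2 by rewrite -subr_le0.
rewrite -(@ler_pM2r _ (Q ^+ 2)) ?exprn_gt0//; apply: le_trans H _.
(* The bound is the maximum over [1 / Q] of a concave quadratic polynomial. *)
rewrite -subr_ge0 (_ : _ - _ = ((N + 2) * Q - 4) ^+ 2 / (2 * rho ^+ 2)).
  by rewrite divr_ge0 ?sqr_ge0 ?mulr_ge0 ?ltW.
by field; rewrite gt_eqF.
Qed.

End max_principle.

(** * Algebra of integrals, and a one-dimensional bump *)

Section cc_algebra.
Context {R : realType}.

Section normed.
Context {V : normedModType R}.
Implicit Types f g : V -> R.

Lemma cc_cst0 : cc (fun _ : V => 0 : R).
Proof. by split; [exact: cst_continuous|exists 0]. Qed.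

Lemma cc_add f g : cc f -> cc g -> cc (fun x => f x + g x).
Proof.
move=> [cf [M fM]] [cg [N gN]]; split.
  suff : forall x, {for x, continuous (fun x => f x + g x)} by [].
  by move=> x; apply: cont_add; [exact: cf|exact: cg].
exists (Num.max M N) => x; rewrite gt_max => /andP[Mx Nx].
by rewrite fM// gN// addr0.
Qed.

Lemma cc_scale k f : cc f -> cc (fun x => k * f x).
Proof.
move=> [cf [M fM]]; split.
  suff : forall x, {for x, continuous (fun x => k * f x)} by [].
  by move=> x; apply: cont_mul; [exact: cont_cst|exact: cf].
by exists M => x Mx; rewrite fM// mulr0.
Qed.

Lemma cc_sqr f : cc f -> cc (fun x => f x ^+ 2).
Proof.
move=> [cf [M fM]]; split.
  suff : forall x, {for x, continuous (fun x => f x ^+ 2)} by [].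
  by move=> x; apply: cont_sqr; exact: cf.
by exists M => x Mx; rewrite fM// expr0n.
Qed.

Lemma cc_sum (I : Type) (r : seq I) (P : pred I) (F : I -> V -> R) :
  (forall i, P i -> cc (F i)) -> cc (fun x => \sum_(i <- r | P i) F i x).
Proof.
move=> ccF; elim: r => [|i r IH].
  rewrite (_ : (fun x => _) = fun=> 0); first exact: cc_cst0.
  by apply/funext => y; rewrite big_nil.
have [Pi|nPi] := boolP (P i).
  rewrite (_ : (fun y => _) = fun y => F i y + \sum_(i <- r | P i) F i y).
    by apply: cc_add => //; exact: ccF.
  by apply/funext => y; rewrite big_cons Pi.
rewrite (_ : (fun y => _) = fun y => \sum_(i <- r | P i) F i y)//.
by apply/funext => y; rewrite big_cons (negbTE nPi).
Qed.

End normed.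

Section integral.
Context {n : nat}.
Implicit Types f g : 'rV[R]_n -> R.

Lemma integral_add f g : cc f -> cc g ->
  \int[lebesgue_rV n]_x (f x + g x) =
  \int[lebesgue_rV n]_x f x + \int[lebesgue_rV n]_x g x.
Proof. by move=> cf cg; rewrite RintegralD//; exact: cc_integrable. Qed.

Lemma integral_scale k f : cc f ->
  \int[lebesgue_rV n]_x (k * f x) = k * \int[lebesgue_rV n]_x f x.
Proof. by move=> cf; rewrite RintegralZl//; exact: cc_integrable. Qed.

Lemma integral_sum (I : Type) (r : seq I) (P : pred I) (F : I -> 'rV[R]_n -> R) :
  (forall i, P i -> cc (F i)) ->
  \int[lebesgue_rV n]_x (\sum_(i <- r | P i) F i x) =
  \sum_(i <- r | P i) \int[lebesgue_rV n]_x F i x.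
Proof.
move=> ccF; elim: r => [|i r IH].
  rewrite big_nil (_ : (fun x => _) = fun=> 0).
    by rewrite /Rintegral integral0.
  by apply/funext => y; rewrite big_nil.
rewrite big_cons; have [Pi|nPi] := boolP (P i).
  rewrite (_ : (fun y => _) = fun y => F i y + \sum_(i <- r | P i) F i y).
    by rewrite integral_add ?IH//; [exact: ccF|exact: cc_sum].
  by apply/funext => y; rewrite big_cons Pi.
rewrite (_ : (fun y => _) = fun y => \sum_(i <- r | P i) F i y)//.
by apply/funext => y; rewrite big_cons (negbTE nPi).
Qed.

End integral.

Definition tail_rV n (X : 'rV[R]_n.+1) : 'rV[R]_n := (uncons_rV X).2.

Lemma tail_cons_rV n t (v : 'rV[R]_n) : tail_rV (cons_rV (t, v)) = v.
Proof. by rewrite /tail_rV cons_rVK. Qed.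

Lemma head_cons_rV n t (v : 'rV[R]_n) : cons_rV (t, v) ord0 ord0 = t.
Proof. by rewrite mxE unlift_none. Qed.

Lemma continuous_tail_rV n : continuous (@tail_rV n).
Proof.
move=> X; apply: continuous_at_rV => i.
rewrite (_ : (fun _ => _) = (fun Y : 'rV[R]_n.+1 => Y ord0 (lift ord0 i))).
  exact: coord_continuous.
by apply/funext => Y; rewrite mxE.
Qed.

Lemma norm_cons_rV_le n (X : 'rV[R]_n.+1) M : 0 <= M ->
  `|X ord0 ord0| <= M -> `|tail_rV X| <= M -> `|X| <= M.
Proof.
move=> M0 hM tM; rewrite [leLHS]/Num.norm /= mx_normrE.
apply/bigmax_leP; split=> // -[i j] _ /=; rewrite (ord1 i).
case: (unliftP ord0 j) => [k ->|->//].
by apply: le_trans tM; have := coord_le_norm (tail_rV X) k; rewrite mxE.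
Qed.

Lemma cc_tensor n (f : R -> R) (G : 'rV[R]_n -> R) : cc f -> cc G ->
  cc (fun X : 'rV[R]_n.+1 => f (X ord0 ord0) * G (tail_rV X)).
Proof.
move=> [cf [M fM]] [cG [N GN]]; split.
  suff : forall X, {for X, continuous
    (fun X : 'rV[R]_n.+1 => f (X ord0 ord0) * G (tail_rV X))} by [].
  move=> X; apply: cont_mul.
    apply: (@continuous_comp _ _ _ (fun X : 'rV[R]_n.+1 => X ord0 ord0) f).
      exact: coord_continuous.
    exact: cf.
  apply: (@continuous_comp _ _ _ (@tail_rV n) G); last exact: cG.
  exact: continuous_tail_rV.
exists (`|M| + `|N|) => X XMN.
have [hM|hM] := ltP M `|X ord0 ord0|; first by rewrite fM// mul0r.
have [tN|tN] := ltP N `|tail_rV X|; first by rewrite GN// mulr0.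
move: XMN; rewrite ltNge norm_cons_rV_le//.
  by rewrite (le_trans hM)// (le_trans (ler_norm _))// lerDl.
by rewrite (le_trans tN)// (le_trans (ler_norm _))// lerDr.
Qed.

Lemma cc_integrable1 (f : R -> R) : cc f ->
  (@lebesgue_measure R).-integrable setT (EFin \o f).
Proof.
move=> [cf [M fM]].
have -> : EFin \o f = (EFin \o f) \_ `[- `|M|, `|M|].
  apply/funext => t; rewrite patchE; case: ifPn => // /negP tN /=.
  rewrite fM// ltNge; apply/negP => tM; apply: tN; apply/mem_set => /=.
  by rewrite in_itv/= -ler_norml (le_trans tM)// ler_norm.
have mI : measurable (`[- `|M|, `|M|]%classic : set (measurableTypeR R)) by exact: measurable_itv.
apply: (iffLR (integrable_mkcond _ mI)).
apply: continuous_compact_integrable; first exact: segment_compact.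
exact: continuous_subspaceT.
Qed.

Lemma integral_tensor n (f : R -> R) (G : 'rV[R]_n -> R) : cc f -> cc G ->
  \int[lebesgue_rV n.+1]_X (f (X ord0 ord0) * G (tail_rV X)) =
  \int[lebesgue_measure]_t f t * \int[lebesgue_rV n]_x G x.
Proof.
move=> ccf ccG; rewrite {1}/Rintegral integral_cons12; last exact: cc_tensor.
rewrite -RintegralZr//; last exact: cc_integrable1.
congr fine; apply: eq_integral => t _.
under eq_integral do rewrite head_cons_rV tail_cons_rV EFinM.
rewrite integralZl//; last exact: cc_integrable.
by rewrite EFinM; congr (_ * _)%E; rewrite /Rintegral fineK// integrable_fin_num//;
  exact: cc_integrable.
Qed.

(** Along [E] the map [L] moves in direction [v] at speed [k]; [k = 0] covers
    the maps that are constant along [E]. *)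
Lemma is_derive_affine (V W : normedModType R) (L : W -> V) (E X : W) (v : V)
    (k l : R) (f : V -> R) :
  (forall t, L (X + t *: E) = L X + (k * t) *: v) ->
  is_derive (L X) v f l -> is_derive X E (fun Y => f (L Y)) (k * l).
Proof.
move=> LE /is_derive_line0 df; apply/is_derive_line0.
have dk : is_derive (0 : R) (1 : R) (fun t : R => k * t) k.
  have := is_derive_mul (is_derive_cst k (0 : R) (1 : R)) (is_derive_id (0 : R) (1 : R)).
  by rewrite mulr1 mul0r addr0.
have df' : is_derive (k * 0) (1 : R) (fun s : R => f (L X + s *: v)) l by rewrite mulr0.
have := is_derive_chain df' dk; rewrite mulrC.
congr (is_derive _ _ _ _); by apply/funext => t; rewrite LE.
Qed.

End cc_algebra.

Lemma integrable_cst_segment {R : realType} (k b : R) :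
  (@lebesgue_measure R).-integrable setT (EFin \o ((fun _ : R => k) \_ `[- b, b])).
Proof.
have mI : measurable (`[- b, b]%classic : set (measurableTypeR R)) by exact: measurable_itv.
rewrite -restrict_EFin; apply: (iffLR (integrable_mkcond _ mI)).
apply: continuous_compact_integrable; first exact: segment_compact.
by apply: continuous_subspaceT => x; exact: cvg_cst.
Qed.

Section bump.
Context {R : realType}.
Variable a : R.
Hypothesis a0 : 0 < a.

(** A continuously differentiable function supported in [[- a, a]]; its exact
    shape only affects the constant in [integral_bump1_ratio]. *)
Definition bump (s : R) : R := pospart (1 - (s / a) ^+ 2) ^+ 2.

Definition bump1 (s : R) : R := 2 * pospart (1 - (s / a) ^+ 2) * (- 2 * s / a ^+ 2).

Lemma is_derive_bump s : is_derive s (1 : R) bump (bump1 s).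
Proof.
have h := is_derive_quadratic 1 0 (- (a ^+ 2)^-1) s.
have := @is_derive_chain _ R _ (fun s : R => 1 + 0 * s + - (a ^+ 2)^-1 * s ^+ 2) s _ _ _
  (is_derive_pospart_sqr _) h.
have E t : 1 + 0 * t + - (a ^+ 2)^-1 * t ^+ 2 = 1 - (t / a) ^+ 2 by rewrite expr_div_n; ring.
rewrite E (_ : (fun y => _) = bump); last by apply/funext => t; rewrite E.
by rewrite (_ : _ * _ = bump1 s)// /bump1; ring.
Qed.

Lemma bump_arg_le0 s : a <= `|s| -> 1 - (s / a) ^+ 2 <= 0.
Proof.
move=> h; rewrite subr_le0 -real_normK ?num_real// expr_ge1//.
by rewrite normrM normfV (gtr0_norm a0) ler_pdivlMr// mul1r.
Qed.

Lemma bump_eq0 s : a <= `|s| -> bump s = 0.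
Proof. by move=> h; rewrite /bump ler0_pospart ?bump_arg_le0// expr0n. Qed.

Lemma bump1_eq0 s : a <= `|s| -> bump1 s = 0.
Proof. by move=> h; rewrite /bump1 ler0_pospart ?bump_arg_le0// mulr0 mul0r. Qed.

Lemma cont_bump_arg s : {for s, continuous (fun s : R => pospart (1 - (s / a) ^+ 2))}.
Proof.
apply: continuous_comp; last exact: cont_pospart.
apply: cont_add; first exact: cont_cst.
apply: cont_opp; apply: cont_sqr; apply: cont_mul; last exact: cont_cst.
exact: cvg_id.
Qed.

Lemma cont_bump s : {for s, continuous bump}.
Proof. exact/cont_sqr/cont_bump_arg. Qed.

Lemma cont_bump1 s : {for s, continuous bump1}.
Proof.
apply: cont_mul; apply: cont_mul; [exact: cont_cst|exact: cont_bump_arg| |exact: cont_cst].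
by apply: cont_mul; [exact: cont_cst|exact: cvg_id].
Qed.

Lemma cc_bump : cc bump.
Proof. by split; [exact: cont_bump|exists a => s /ltW/bump_eq0]. Qed.

Lemma cc_bump1 : cc bump1.
Proof. by split; [exact: cont_bump1|exists a => s /ltW/bump1_eq0]. Qed.

Lemma integral_bump_ge : a / 4 <= \int[lebesgue_measure]_s (bump s ^+ 2).
Proof.
have mI : measurable (`[- (a / 2), (a / 2)]%classic : set (measurableTypeR R)) by exact: measurable_itv.
have cI : a / 4 = \int[lebesgue_measure]_(s in `[- (a / 2), a / 2]) (1 / 4).
  rewrite Rintegral_cst//= lebesgue_measure_itv/= lte_fin ifT; last first.
    by rewrite -subr_gt0 opprK addr_gt0 ?divr_gt0.
  by rewrite /=; field.
have ib : (@lebesgue_measure R).-integrable setT (EFin \o (fun s => bump s ^+ 2)).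
  exact/cc_integrable1/cc_sqr/cc_bump.
rewrite cI Rintegral_mkcond; apply: le_Rintegral => //.
  exact: integrable_cst_segment.
move=> s _; rewrite patchE; case: ifPn => [|_]; last exact: sqr_ge0.
rewrite inE/= in_itv/= => /andP[s1 s2].
have hs : (s / a) ^+ 2 <= 1 / 4.
  rewrite expr_div_n ler_pdivrMr ?exprn_gt0//; nra.
have h : 3 / 4 <= pospart (1 - (s / a) ^+ 2) by rewrite ger0_pospart; lra.
rewrite /bump; move: h; set p := pospart _ => h.
have : 9 / 16 <= p ^+ 2 by nra.
nra.
Qed.

Lemma integral_bump1_ub : \int[lebesgue_measure]_s (bump1 s ^+ 2) <= 32 / a.
Proof.
have mI : measurable (`[- a, a]%classic : set (measurableTypeR R)) by exact: measurable_itv.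
have -> : 32 / a = \int[lebesgue_measure]_(s in `[- a, a]) (16 / a ^+ 2).
  rewrite Rintegral_cst//= lebesgue_measure_itv/= lte_fin ifT; last first.
    by rewrite -subr_gt0 opprK addr_gt0 ?divr_gt0.
  by rewrite /=; field; rewrite gt_eqF.
have ib : (@lebesgue_measure R).-integrable setT (EFin \o (fun s => bump1 s ^+ 2)).
  exact/cc_integrable1/cc_sqr/cc_bump1.
rewrite [leRHS]Rintegral_mkcond; apply: le_Rintegral => //.
  exact: integrable_cst_segment.
move=> s _; rewrite patchE; case: ifPn => [|/negP sN]; last first.
  rewrite bump1_eq0 ?expr0n// leNgt; apply/negP => sa; apply: sN.
  by apply/mem_set; rewrite /= in_itv/= -ler_norml ltW.
rewrite inE/= in_itv/= => /andP[s1 s2].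
have p0 := pospart_ge0 (1 - (s / a) ^+ 2).
have p1 : pospart (1 - (s / a) ^+ 2) <= 1.
  by rewrite /pospart ge_max ler01 andbT gerBl sqr_ge0.
rewrite /bump1; move: p0 p1; set p := pospart _ => p0 p1.
rewrite (_ : _ ^+ 2 = 16 / a ^+ 2 * (p ^+ 2 * (s ^+ 2 / a ^+ 2))); last first.
  by field; rewrite gt_eqF.
rewrite ler_piMr// ?divr_ge0// ?sqr_ge0//.
rewrite mulr_ile1 ?sqr_ge0 ?divr_ge0 ?sqr_ge0 ?expr_le1//.
by rewrite ler_pdivrMr ?exprn_gt0// mul1r; nra.
Qed.

Lemma integral_bump1_ratio : \int[lebesgue_measure]_s (bump1 s ^+ 2) <=
  128 / a ^+ 2 * \int[lebesgue_measure]_s (bump s ^+ 2).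
Proof.
apply: le_trans integral_bump1_ub _.
rewrite (_ : 32 / a = 128 / a ^+ 2 * (a / 4)); last by field; rewrite gt_eqF.
by rewrite ler_wpM2l ?integral_bump_ge// divr_ge0 ?sqr_ge0.
Qed.

End bump.

(** * The energy identity for the truncated eigenfunction *)

Section positive_solution.
Context {R : realType} {n : nat}.
Variables (Om : set 'rV[R]_n) (lambda : R) (u : 'rV[R]_n -> R).
Hypotheses (openOm : open Om) (bdOm : bounded_set Om).
Hypotheses (solu : dirichlet_solution Om lambda u) (u0 : forall x, Om x -> 0 < u x).

Let C1u : C1_on Om u. Proof. by have [[]] := solu. Qed.
Let C2u i : C1_on Om (partial i u). Proof. by have [[_ h] _ _ _] := solu; exact: h. Qed.

(** The extension of [u] by 0 is continuous on the whole space because of the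
    boundary condition, and its superlevel sets at positive levels are compact subsets of [Om]. *)
Definition ext0 : 'rV[R]_n -> R := u \_ Om.
Local Notation uh := ext0.

Lemma ext0E x : Om x -> uh x = u x.
Proof. by move=> Ox; rewrite /uh patchE mem_set. Qed.

Lemma ext0_out x : ~ Om x -> uh x = 0.
Proof. by move=> Ox; rewrite /uh patchE memNset. Qed.

Lemma ext0_ge0 x : 0 <= uh x.
Proof.
have [Ox|nOx] := pselect (Om x); first by rewrite ext0E// ltW// u0.
by rewrite ext0_out.
Qed.

Lemma ext0_gt0 x : 0 < uh x -> Om x.
Proof.
have [//|nOx] := pselect (Om x); by rewrite ext0_out// ltxx.
Qed.

Lemma ext0_neq0 x : Om x -> uh x != 0.
Proof. by move=> Ox; rewrite gt_eqF// ext0E// u0. Qed.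

Lemma near_Om x : Om x -> \forall y \near x, Om y.
Proof. by move=> Ox; exact: open_nbhs_nbhs. Qed.

Lemma cont_ext0 : continuous uh.
Proof.
have [_ /subspace_continuousP cu _ bdry] := solu.
move=> x; suff : uh y @[y --> x] --> uh x by [].
apply: (iffRL (@cvgrPdist_lt _ _ _ (nbhs x) _ uh (uh x))) => e e0.
(* Continuity of [u] is only given relatively to the closure of [Om]. *)
have [clx|nclx] := pselect (closure Om x); last first.
  have : \forall y \near x, ~ closure Om y.
    apply: (@open_nbhs_nbhs _ _ (~` closure Om)); split => //.
    by apply: closed_openC; exact: closed_closure.
  apply: filterS => y ncly.
  have h z : ~ closure Om z -> ~ Om z by move=> + Oz; apply; exact: subset_closure.
  by rewrite !ext0_out ?subrr ?normr0//; exact: h.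
have uhx : uh x = u x.
  have [Ox|nOx] := pselect (Om x); first exact: ext0E.
  by rewrite ext0_out// bdry.
have /cvgrPdist_lt /(_ _ e0) cux := cu x clx.
have {}cux : \forall y \near x, closure Om y -> `|u x - u y| < e by exact: cux.
have [Ox|nOx] := pselect (Om x).
  near=> y; have Oy : Om y by near: y; exact: near_Om.
  rewrite !ext0E//; suff : closure Om y by near: y; exact: cux.
  exact: subset_closure.
apply: filterS cux => y hy.
have [Oy|nOy] := pselect (Om y).
  by rewrite uhx ext0E//; apply: hy; exact: subset_closure.
by rewrite !ext0_out ?subrr ?normr0.
Unshelve. all: by end_near. Qed.

Lemma is_derive_ext0 i x : Om x -> is_derive x (delta_mx ord0 i) uh (partial i u x).
Proof.
move=> Ox; have [/derivableP d _] := C1u i Ox.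
have h : \forall y \near x, u y = uh y.
  by apply: filterS (near_Om Ox) => y Oy; rewrite ext0E.
exact: (near_eq_is_derive h d).
Qed.

Lemma is_derive_partial i x : Om x ->
  is_derive x (delta_mx ord0 i) (partial i u) (partial i (partial i u) x).
Proof. by move=> Ox; have [/derivableP d _] := C2u i i Ox. Qed.

Lemma cont_partial i x : Om x -> {for x, continuous (partial i u)}.
Proof. by move=> Ox; have [] := C1u i Ox. Qed.

Lemma cont_partial2 i x : Om x -> {for x, continuous (partial i (partial i u))}.
Proof. by move=> Ox; have [] := C2u i i Ox. Qed.

Variable e : R.
Hypothesis e0 : 0 < e.

Let S := [set x | e <= uh x].

Let clS : closed S.
Proof.
rewrite (_ : S = [set x | - uh x <= - e]); last first.
  by apply/seteqP; split => x; rewrite /S /= lerN2.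
by apply: closed_sublevel => x; apply: cont_opp; exact: cont_ext0.
Qed.

Let SOm : S `<=` Om.
Proof. by move=> x Sx; apply: ext0_gt0; exact: lt_le_trans Sx. Qed.

Let bdS : bounded_set S.
Proof.
by have [M [Mr bO]] := bdOm; exists M; split => // K MK x /SOm; exact: (bO _ MK).
Qed.

Let nS x : ~ S x -> uh x <= e.
Proof. by move=> /negP; rewrite -ltNge; exact: ltW. Qed.

(** Applies to any expression containing a factor [cutoff] or [cutoff1] of the
    extension, which vanishes near the boundary of [Om]. *)
Lemma cc_superlevel (f : 'rV[R]_n -> R) :
  (forall x, Om x -> {for x, continuous f}) ->
  (forall x, uh x <= e -> f x = 0) -> cc f.
Proof. by move=> cf f0; apply: (cc_patch clS bdS SOm cf) => x /nS/f0. Qed.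

Lemma cont_cutoff_ext0 x : Om x -> {for x, continuous (fun y => cutoff e (uh y))}.
Proof.
move=> Ox; apply: continuous_comp; first exact: cont_ext0.
exact/cont_cutoff/ext0_neq0.
Qed.

Lemma cont_cutoff1_ext0 x : Om x -> {for x, continuous (fun y => cutoff1 e (uh y))}.
Proof.
move=> Ox; apply: continuous_comp; first exact: cont_ext0.
exact/cont_cutoff1/ext0_neq0.
Qed.

Lemma is_derive_cutoff_ext0 i x : Om x -> is_derive x (delta_mx ord0 i)
  (fun y => cutoff e (uh y)) (cutoff1 e (uh x) * partial i u x).
Proof.
move=> Ox; apply: is_derive_chain; last exact: is_derive_ext0.
exact/is_derive_cutoff/ext0_neq0.
Qed.

Definition cutoff_energy i : 'rV[R]_n -> R :=
  fun x => cutoff1 e (uh x) * partial i u x ^+ 2.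

Lemma cc_cutoff_energy i : cc (cutoff_energy i).
Proof.
apply: cc_superlevel => x Ox; last by rewrite /cutoff_energy cutoff1_eq0// mul0r.
by apply: cont_mul; [exact: cont_cutoff1_ext0|exact/cont_sqr/cont_partial].
Qed.

Lemma cc_cutoff_mul (f : 'rV[R]_n -> R) : (forall x, Om x -> {for x, continuous f}) ->
  cc (fun x => cutoff e (uh x) * f x).
Proof.
move=> cf; apply: cc_superlevel => x Ox; last by rewrite cutoff_eq0// mul0r.
by apply: cont_mul; [exact: cont_cutoff_ext0|exact: cf].
Qed.

(** Integration by parts of the derivative of [cutoff e uh * partial i u]. *)
Lemma integral_cutoff_energy i :
  \int[lebesgue_rV n]_x cutoff_energy i x =
  - \int[lebesgue_rV n]_x (cutoff e (uh x) * partial i (partial i u) x).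
Proof.
have cc2 := cc_cutoff_mul (@cont_partial2 i).
apply/eqP; rewrite -addr_eq0 -integral_add//; last exact: cc_cutoff_energy.
apply/eqP.
apply: (@integral_partial_patch _ _ i S Om (fun x => cutoff e (uh x) * partial i u x)) => // x Ox.
- by apply: cont_mul; [exact: cont_cutoff_ext0|exact: cont_partial].
- apply: cont_add.
    by apply: cont_mul; [exact: cont_cutoff1_ext0|exact/cont_sqr/cont_partial].
  by apply: cont_mul; [exact: cont_cutoff_ext0|exact: cont_partial2].
- have := is_derive_mul (is_derive_cutoff_ext0 i Ox) (is_derive_partial i Ox).
  by rewrite (_ : _ + _ = cutoff_energy i x + cutoff e (uh x) * partial i (partial i u) x)//
    /cutoff_energy; ring.
- by rewrite cutoff_eq0 ?mul0r//; exact: nS.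
- by rewrite /cutoff_energy cutoff_eq0 ?cutoff1_eq0 ?mul0r ?addr0//; exact: nS.
Qed.

(** The weak form of the eigenvalue equation, tested with [cutoff e uh]. *)
Lemma sum_cutoff_energy :
  \sum_i \int[lebesgue_rV n]_x cutoff_energy i x =
  lambda * \int[lebesgue_rV n]_x (cutoff e (uh x) * uh x).
Proof.
under eq_bigr do rewrite integral_cutoff_energy.
rewrite sumrN -integral_sum; last by move=> i _; apply: cc_cutoff_mul; exact: cont_partial2.
have ccu : cc (fun x => cutoff e (uh x) * uh x).
  by apply: cc_cutoff_mul => x _; exact: cont_ext0.
rewrite -integral_scale// -mulN1r -integral_scale; last first.
  by apply: cc_sum => i _; apply: cc_cutoff_mul; exact: cont_partial2.
apply: eq_Rintegral => x _; rewrite -mulr_sumr.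
have [Ox|nOx] := pselect (Om x); last by rewrite ext0_out// cutoff_eq0 ?ltW//; ring.
have [_ _ /(_ x Ox) eqn _] := solu.
have -> : \sum_i partial i (partial i u) x = - (lambda * uh x).
  by apply/eqP; rewrite -addr_eq0 ext0E// eqn.
ring.
Qed.

End positive_solution.

(** * Comparing the eigenfunction with its slices *)

Section nonneg_integral.
Context {R : realType} {n : nat}.
Implicit Types f g : 'rV[R]_n -> R.

(** The conclusion of Picone's inequality; these functions form a convex cone. *)
Definition cc_integral_ge0 f := cc f /\ 0 <= \int[lebesgue_rV n]_x f x.

Lemma cc_integral_ge0D f g : cc_integral_ge0 f -> cc_integral_ge0 g ->
  cc_integral_ge0 (fun x => f x + g x).
Proof.
move=> [cf f0] [cg g0]; split; first exact: cc_add.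
by rewrite integral_add// addr_ge0.
Qed.

Lemma cc_integral_ge0Z k f : 0 <= k -> cc_integral_ge0 f ->
  cc_integral_ge0 (fun x => k * f x).
Proof.
move=> k0 [cf f0]; split; first exact: cc_scale.
by rewrite integral_scale// mulr_ge0.
Qed.

Lemma cc_integral_ge0_sum (I : Type) (r : seq I) (P : pred I) (F : I -> 'rV[R]_n -> R) :
  (forall i, P i -> cc_integral_ge0 (F i)) ->
  cc_integral_ge0 (fun x => \sum_(i <- r | P i) F i x).
Proof.
move=> h; split; first by apply: cc_sum => i /h[].
by rewrite integral_sum => [|i /h[]//]; apply: sumr_ge0 => i /h[].
Qed.

End nonneg_integral.

Lemma is_derive_scale {R : realType} {V : normedModType R} k (f : V -> R) x v a :
  is_derive x v f a -> is_derive x v (fun y => k * f y) (k * a).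
Proof.
move=> df; have := is_derive_mul (is_derive_cst k x v) df.
by rewrite mul0r addr0.
Qed.

Lemma convex_set_comb {R : realType} {n} (A : set 'rV[R]_n) x y (d : R) :
  convex_set A -> 0 <= d -> d <= 1 -> A x -> A y -> A ((1 - d) *: x + d *: y).
Proof.
move=> cA d0 d1 Ax Ay; have := cA y x (Itv01 d0 d1) (mem_set Ay) (mem_set Ax).
by rewrite inE addrC.
Qed.

Section comparison.
Context {R : realType} {n : nat}.
Variables (Om : set 'rV[R]_n) (lambda : R) (u : 'rV[R]_n -> R).
Hypotheses (openOm : open Om) (bdOm : bounded_set Om) (convOm : convex_set Om).
Hypotheses (solu : dirichlet_solution Om lambda u) (u0 : forall x, Om x -> 0 < u x).
Variables (e : R) (j : 'I_n) (c : 'rV[R]_n) (delta a : R).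
Hypotheses (e0 : 0 < e) (delta0 : 0 < delta) (delta1 : delta < 1) (a0 : 0 < a).
Hypothesis segOm : forall s, `|s| <= a -> Om (c + s *: delta_mx ord0 j).

Local Notation uh := (ext0 Om u).

(* The head of [X] is the parameter [s] of the segment, its tail a point of the
   space.  Convexity makes [Om] stable under [x |-> L (s, x)]. *)
Let L (X : 'rV[R]_n.+1) : 'rV[R]_n :=
  (1 - delta) *: tail_rV X + delta *: (c + X ord0 ord0 *: delta_mx ord0 j).

Let O := [set X | Om (tail_rV X) /\ Om (L X)].

Let S := [set X : 'rV[R]_n.+1 | `|X ord0 ord0| <= a /\ e <= uh (tail_rV X)].

(* The test function: for fixed [j]-th coordinate of the tail it is a product of
   a bump and a truncated slice of [u]. *)
Let w (X : 'rV[R]_n.+1) := bump a (X ord0 ord0) * cutoff e (uh (tail_rV X)).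

Let cL : continuous L.
Proof.
move=> X; apply: continuous_at_rV => i.
rewrite (_ : (fun _ => _) = fun Y : 'rV[R]_n.+1 => (1 - delta) * Y ord0 (lift ord0 i) +
    delta * (c ord0 i + Y ord0 ord0 * (delta_mx ord0 j : 'rV[R]_n) ord0 i)); last first.
  by apply/funext => Y; rewrite !mxE.
have cc0 k (Y : 'rV[R]_n.+1) :
    {for Y, continuous (fun Y : 'rV[R]_n.+1 => Y ord0 k)} by exact: coord_continuous.
apply: cont_add; apply: cont_mul; [exact: cont_cst|exact: cc0|exact: cont_cst|].
apply: cont_add; first exact: cont_cst.
by apply: cont_mul; [exact: cc0|exact: cont_cst].
Qed.

Let cuh := cont_ext0 openOm solu.

Let cuhT (X : 'rV[R]_n.+1) : {for X, continuous (fun Y => uh (tail_rV Y))}.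
Proof. by apply: continuous_comp; [exact: continuous_tail_rV|exact: cuh]. Qed.

Let clS : closed S.
Proof.
rewrite (_ : S = [set X : 'rV[R]_n.+1 | `|X ord0 ord0| <= a] `&`
    [set X : 'rV[R]_n.+1 | - uh (tail_rV X) <= - e]); last first.
  by apply/seteqP; split => X [h1 h2]; split => //; move: h2; rewrite /= lerN2.
apply: closedI; apply: closed_sublevel.
  move=> X; apply: (@continuous_comp _ _ _ (fun X : 'rV[R]_n.+1 => X ord0 ord0) Num.norm).
    exact: coord_continuous.
  exact: norm_continuous.
suff : forall X, {for X, continuous (fun Y : 'rV[R]_n.+1 => - uh (tail_rV Y))} by [].
by move=> X; apply: cont_opp; exact: cuhT.
Qed.

Let SO : S `<=` O.
Proof.
move=> X [hX tX]; have OT : Om (tail_rV X).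
  by apply: (ext0_gt0 (lt_le_trans e0 tX)).
split => //; apply: convex_set_comb => //; [exact: ltW|exact: ltW|exact: segOm].
Qed.

Let bdS : bounded_set S.
Proof.
have [M [Mr bO]] := bdOm; exists (Num.max `|M| a); split; first exact: num_real.
move=> K; rewrite gt_max => /andP[MK aK] X SX; have [OT _] := SO SX.
have [hX _] := SX; apply: norm_cons_rV_le; first by rewrite (le_trans _ (ltW MK)).
  by rewrite (le_trans hX)// ltW.
by apply: bO => //; rewrite (le_lt_trans _ MK)// ler_norm.
Qed.

Let nSP X : ~ S X -> a <= `|X ord0 ord0| \/ uh (tail_rV X) <= e.
Proof.
move=> nS; have [h|h] := leP a `|X ord0 ord0|; first by left.
right; rewrite leNgt; apply/negP => h2; apply: nS; split; exact: ltW.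
Qed.

Let w_eq0 X : ~ S X -> w X = 0.
Proof.
by move=> /nSP[h|h]; rewrite /w; [rewrite bump_eq0// mul0r|rewrite cutoff_eq0// mulr0].
Qed.

Let cont_head (f : R -> R) (X : 'rV[R]_n.+1) : (forall s, {for s, continuous f}) ->
  {for X, continuous (fun Y : 'rV[R]_n.+1 => f (Y ord0 ord0))}.
Proof.
move=> cf; apply: (@continuous_comp _ _ _ (fun X : 'rV[R]_n.+1 => X ord0 ord0) f).
  exact: coord_continuous.
exact: cf.
Qed.

Let cont_tail (f : 'rV[R]_n -> R) X : {for (tail_rV X), continuous f} ->
  {for X, continuous (fun Y => f (tail_rV Y))}.
Proof.
move=> cf; apply: (@continuous_comp _ _ _ (@tail_rV R n) f).
  exact: continuous_tail_rV.
exact: cf.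
Qed.

Let cont_L (f : 'rV[R]_n -> R) X : {for (L X), continuous f} ->
  {for X, continuous (fun Y => f (L Y))}.
Proof. by move=> cf; apply: (@continuous_comp _ _ _ L f); [exact: cL|exact: cf]. Qed.

Let cw X : O X -> {for X, continuous w}.
Proof.
move=> [OT _]; apply: cont_mul; first by apply: cont_head; exact: cont_bump.
exact: (@cont_tail (fun y => cutoff e (uh y)) X (@cont_cutoff_ext0 _ _ _ _ _ openOm solu u0 e _ OT)).
Qed.

(* Picone's integrand in a direction along which [L] moves in direction [i] at
   speed [k], the positive function being [uh \o L]. *)
Let picone_term k i (w1 : 'rV[R]_n.+1 -> R) X :=
  w1 X ^+ 2 + k * (k * partial i (partial i u) (L X)) / uh (L X) * w X ^+ 2.

(* [L] is affine, so the second derivative of [uh \o L] along the direction [i']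
   is [k ^ 2] times the one of [u] in direction [i]. *)
Let picone_L (i' : 'I_n.+1) (i : 'I_n) k w1 :
  (forall X t, L (X + t *: delta_mx ord0 i') = L X + (k * t) *: delta_mx ord0 i) ->
  (forall X, O X -> is_derive X (delta_mx ord0 i') w (w1 X)) ->
  (forall X, O X -> {for X, continuous w1}) ->
  (forall X, ~ S X -> w1 X = 0) ->
  cc_integral_ge0 (picone_term k i w1).
Proof.
move=> LE dw cw1 w10.
have cU X : O X -> {for X, continuous (fun Y => uh (L Y))}.
  by move=> _; apply: cont_L; exact: cuh.
have cU1 X : O X -> {for X, continuous (fun Y => k * partial i u (L Y))}.
  move=> [_ OL]; apply: cont_mul; first exact: cont_cst.
  exact: (@cont_L _ X (@cont_partial _ _ _ _ _ solu i _ OL)).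
have cU2 X : O X ->
    {for X, continuous (fun Y => k * (k * partial i (partial i u) (L Y)))}.
  move=> [_ OL]; apply: cont_mul; first exact: cont_cst.
  apply: cont_mul; first exact: cont_cst.
  exact: (@cont_L _ X (@cont_partial2 _ _ _ _ _ solu i _ OL)).
have U0 X : O X -> 0 < uh (L X) by move=> [_ OL]; rewrite ext0E// u0.
have dU X : O X ->
    is_derive X (delta_mx ord0 i') (fun Y => uh (L Y)) (k * partial i u (L X)).
  move=> [_ OL]; apply: is_derive_affine; first exact: LE.
  exact: (@is_derive_ext0 _ _ _ _ _ openOm solu i _ OL).
have dU1 X : O X -> is_derive X (delta_mx ord0 i') (fun Y => k * partial i u (L Y))
    (k * (k * partial i (partial i u) (L X))).
  move=> [_ OL]; apply: is_derive_scale; apply: is_derive_affine; first exact: LE.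
  exact: (@is_derive_partial _ _ _ _ _ solu i _ OL).
split; first exact: (cc_picone clS bdS SO cw cw1 cU cU2 U0 w_eq0 w10).
exact: (picone clS bdS SO cw cw1 cU cU1 cU2 dw dU dU1 U0 w_eq0 w10).
Qed.

Let tailE0 (X : 'rV[R]_n.+1) t : tail_rV (X + t *: delta_mx ord0 ord0) = tail_rV X.
Proof. by apply/rowP => i; rewrite !mxE /= mulr0 addr0. Qed.

Let headE0 (X : 'rV[R]_n.+1) t :
  (X + t *: delta_mx ord0 ord0) ord0 ord0 = X ord0 ord0 + t.
Proof. by rewrite !mxE !eqxx mulr1. Qed.

Let tailEi i (X : 'rV[R]_n.+1) t :
  tail_rV (X + t *: delta_mx ord0 (lift ord0 i)) = tail_rV X + t *: delta_mx ord0 i.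
Proof. by apply/rowP => k; rewrite !mxE /= (inj_eq lift_inj). Qed.

Let headEi i (X : 'rV[R]_n.+1) t :
  (X + t *: delta_mx ord0 (lift ord0 i)) ord0 ord0 = X ord0 ord0.
Proof. by rewrite !mxE /= mulr0 addr0. Qed.

Let LE0 X t : L (X + t *: delta_mx ord0 ord0) = L X + (delta * t) *: delta_mx ord0 j.
Proof.
rewrite /L tailE0 headE0 (scalerDl (delta_mx ord0 j)) (addrA c).
by rewrite [in LHS](scalerDr delta) scalerA addrA.
Qed.

Let LEi i X t : L (X + t *: delta_mx ord0 (lift ord0 i)) =
  L X + ((1 - delta) * t) *: delta_mx ord0 i.
Proof. by rewrite /L tailEi headEi scalerDr scalerA addrAC. Qed.

Let w1_0 (X : 'rV[R]_n.+1) := bump1 a (X ord0 ord0) * cutoff e (uh (tail_rV X)).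

Let w1_i i (X : 'rV[R]_n.+1) := bump a (X ord0 ord0) *
  (cutoff1 e (uh (tail_rV X)) * partial i u (tail_rV X)).

Let picone0 : cc_integral_ge0 (picone_term delta j w1_0).
Proof.
apply: (@picone_L _ _ _ _ LE0) => [X [OT OL]|X [OT OL]|X /nSP[h|h]].
- have d1 : is_derive X (delta_mx ord0 ord0) (fun Y => bump a (Y ord0 ord0))
      (1 * bump1 a (X ord0 ord0)).
    apply: (@is_derive_affine _ _ _ (fun Y : 'rV[R]_n.+1 => Y ord0 ord0) _ _ 1).
      by move=> t; rewrite headE0 mul1r [t%:A]mulr1.
    exact: is_derive_bump.
  have d2 : is_derive X (delta_mx ord0 ord0) (fun Y => cutoff e (uh (tail_rV Y)))
      (0 * (cutoff1 e (uh (tail_rV X)) * partial j u (tail_rV X))).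
    apply: (@is_derive_affine _ _ _ (@tail_rV R n) _ _ (delta_mx ord0 j) _ _
      (fun y => cutoff e (uh y))).
      by move=> t; rewrite tailE0 mul0r scale0r addr0.
    exact: (@is_derive_cutoff_ext0 _ _ _ _ _ openOm solu u0 e _ _ OT).
  have := is_derive_mul d1 d2; rewrite mul0r mulr0 add0r mul1r; exact.
- apply: cont_mul; first by apply: cont_head; exact: cont_bump1.
  exact: (@cont_tail (fun y => cutoff e (uh y)) X (@cont_cutoff_ext0 _ _ _ _ _ openOm solu u0 e _ OT)).
- by rewrite /w1_0 bump1_eq0// mul0r.
- by rewrite /w1_0 cutoff_eq0// mulr0.
Qed.

Let piconei i : cc_integral_ge0 (picone_term (1 - delta) i (w1_i i)).
Proof.
apply: (@picone_L _ _ _ _ (LEi i)) => [X [OT OL]|X [OT OL]|X /nSP[h|h]].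
- have d1 : is_derive X (delta_mx ord0 (lift ord0 i)) (fun Y => bump a (Y ord0 ord0))
      (0 * bump1 a (X ord0 ord0)).
    apply: (@is_derive_affine _ _ _ (fun Y : 'rV[R]_n.+1 => Y ord0 ord0) _ _ 1).
      by move=> t; rewrite headEi mul0r scale0r addr0.
    exact: is_derive_bump.
  have d2 : is_derive X (delta_mx ord0 (lift ord0 i))
      (fun Y => cutoff e (uh (tail_rV Y)))
      (1 * (cutoff1 e (uh (tail_rV X)) * partial i u (tail_rV X))).
    apply: (@is_derive_affine _ _ _ (@tail_rV R n) _ _ (delta_mx ord0 i) _ _
      (fun y => cutoff e (uh y))).
      by move=> t; rewrite tailEi mul1r.
    exact: (@is_derive_cutoff_ext0 _ _ _ _ _ openOm solu u0 e _ _ OT).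
  have := is_derive_mul d1 d2; rewrite !mul0r addr0 mul1r; exact.
- apply: cont_mul; first by apply: cont_head; exact: cont_bump.
  have c1 := @cont_cutoff1_ext0 _ _ _ _ _ openOm solu u0 e _ OT.
  exact: (@cont_tail (fun y => cutoff1 e (uh y) * partial i u y) X
    (cont_mul c1 (@cont_partial _ _ _ _ _ solu i _ OT))).
- by rewrite /w1_i bump_eq0// mul0r.
- by rewrite /w1_i cutoff1_eq0// mul0r mulr0.
Qed.

Definition cutoff_partial i x := cutoff1 e (uh x) * partial i u x.

(** The weights [(1 - delta) ^- 2] and [delta ^- 2] cancel the speeds of [L], so
    that the terms of Picone's inequality in which [u] is differentiated twice
    add up to the Laplacian of [u] at [L X].  The direction [j] of the tail is
    left out: the direction of the head stands for it. *)
Lemma comparison_integral :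
  0 <= \int[lebesgue_rV n.+1]_X
    (bump a (X ord0 ord0) ^+ 2 *
       ((1 - delta) ^- 2 * (\sum_(i | i != j) cutoff_partial i (tail_rV X) ^+ 2) -
        lambda * cutoff e (uh (tail_rV X)) ^+ 2) +
     bump1 a (X ord0 ord0) ^+ 2 * (delta ^- 2 * cutoff e (uh (tail_rV X)) ^+ 2)).
Proof.
have d1 : 1 - delta != 0 by rewrite gt_eqF// subr_gt0.
have [_] : cc_integral_ge0 (fun X =>
    \sum_(i | i != j) ((1 - delta) ^- 2 * picone_term (1 - delta) i (w1_i i) X)
    + delta ^- 2 * picone_term delta j w1_0 X).
  apply: cc_integral_ge0D.
    apply: cc_integral_ge0_sum => i _; apply: cc_integral_ge0Z; last exact: piconei.
    by rewrite invr_ge0 sqr_ge0.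
  by apply: cc_integral_ge0Z; [rewrite invr_ge0 sqr_ge0|exact: picone0].
congr (_ <= _); apply: eq_Rintegral => X _; rewrite /picone_term.
have E1 : \sum_(i | i != j) (1 - delta) ^- 2 * (w1_i i X ^+ 2 +
   (1 - delta) * ((1 - delta) * partial i (partial i u) (L X)) / uh (L X) * w X ^+ 2) =
   (1 - delta) ^- 2 * \sum_(i | i != j) w1_i i X ^+ 2 +
   (\sum_(i | i != j) partial i (partial i u) (L X)) * (w X ^+ 2 / uh (L X)).
  rewrite mulr_sumr mulr_suml -big_split /=; apply: eq_bigr => i _.
  rewrite mulrDr; congr (_ + _); move: (_ (L X)) (uh (L X))^-1 => p q; by field.
have E2 : (\sum_(i | i != j) partial i (partial i u) (L X)) * (w X ^+ 2 / uh (L X))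
   + partial j (partial j u) (L X) * (w X ^+ 2 / uh (L X)) = - lambda * w X ^+ 2.
  rewrite -mulrDl (_ : _ + _ = \sum_i partial i (partial i u) (L X)); last first.
    by rewrite [RHS](bigD1 j)//= addrC.
  have [SX|nSX] := pselect (S X); last by rewrite w_eq0// expr0n/= mul0r !mulr0.
  have [_ OL] := SO SX; have [_ _ /(_ _ OL) eqn _] := solu.
  have -> : \sum_i partial i (partial i u) (L X) = - (lambda * uh (L X)).
    by apply/eqP; rewrite -addr_eq0 ext0E// eqn.
  by field; exact: ext0_neq0.
rewrite E1.
have E3 : \sum_(i | i != j) w1_i i X ^+ 2 = bump a (X ord0 ord0) ^+ 2 *
    \sum_(i | i != j) cutoff_partial i (tail_rV X) ^+ 2.
  by rewrite mulr_sumr; apply: eq_bigr => i _; rewrite /w1_i exprMn.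
have E4 : delta ^- 2 * (w1_0 X ^+ 2 + delta * (delta * partial j (partial j u) (L X))
    / uh (L X) * w X ^+ 2) = delta ^- 2 * w1_0 X ^+ 2 +
    partial j (partial j u) (L X) * (w X ^+ 2 / uh (L X)).
  rewrite mulrDr; congr (_ + _); move: (_ (L X)) (uh (L X))^-1 => p q; field.
  by rewrite gt_eqF.
rewrite E4 addrACA E2 E3 /w1_0 /w !exprMn; ring.
Qed.

End comparison.

(** * The energy estimate *)

Section energy_bound.
Context {R : realType} {n : nat}.
Variables (Om : set 'rV[R]_n) (lambda : R) (u : 'rV[R]_n -> R).
Hypotheses (openOm : open Om) (bdOm : bounded_set Om) (convOm : convex_set Om).
Hypotheses (solu : dirichlet_solution Om lambda u) (u0 : forall x, Om x -> 0 < u x).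
Variables (j : 'I_n) (c : 'rV[R]_n) (delta a : R).
Hypotheses (delta0 : 0 < delta) (delta1 : delta < 1) (a0 : 0 < a).
Hypothesis segOm : forall s, `|s| <= a -> Om (c + s *: delta_mx ord0 j).

Local Notation uh := (ext0 Om u).
Local Notation I f := (\int[lebesgue_rV n]_x f x).

Let cuh : continuous uh := cont_ext0 openOm solu.

Lemma cc_ext0 : cc uh.
Proof.
split; first exact: cuh.
have [M [Mr bO]] := bdOm; exists (M + 1) => x Mx; apply: ext0_out => Ox.
by move: Mx; rewrite ltNge (bO (M + 1))// ltrDl.
Qed.

Lemma cc_cutoff_partial e i : 0 < e -> cc (cutoff_partial Om u e i).
Proof.
move=> e0; apply: (cc_superlevel openOm bdOm solu e0) => x Ox.
  apply: cont_mul; last exact: (@cont_partial _ _ _ _ _ solu i _ Ox).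
  exact: (@cont_cutoff1_ext0 _ _ _ _ _ openOm solu u0 e _ Ox).
by rewrite /cutoff_partial cutoff1_eq0// mul0r.
Qed.

Lemma cc_cutoff e : 0 < e -> cc (fun x => cutoff e (uh x)).
Proof.
move=> e0; apply: (cc_superlevel openOm bdOm solu e0) => x Ox.
  exact: (@cont_cutoff_ext0 _ _ _ _ _ openOm solu u0 e _ Ox).
exact: cutoff_eq0.
Qed.

Let D e i := I (cutoff_energy Om u e i).

(** [comparison_integral] with the two groups of variables separated: the bump
    contributes only the ratio of the integrals of [bump1 ^ 2] and [bump ^ 2]. *)
Lemma comparison_energy e : 0 < e ->
  0 <= (1 - delta) ^- 2 * \sum_(i | i != j) D e i +
    (128 / a ^+ 2 / delta ^+ 2 - lambda) * I (fun x => cutoff e (uh x) ^+ 2).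
Proof.
move=> e0.
set A := \int[lebesgue_measure]_s (bump a s ^+ 2).
set B := \int[lebesgue_measure]_s (bump1 a s ^+ 2).
have A0 : 0 < A by apply: lt_le_trans (integral_bump_ge a0); rewrite divr_gt0.
have BA : B <= 128 / a ^+ 2 * A by exact: integral_bump1_ratio.
set P := I (fun x => cutoff e (uh x) ^+ 2).
have P0 : 0 <= P by apply: Rintegral_ge0 => x _; exact: sqr_ge0.
have ccP : cc (fun x => cutoff e (uh x) ^+ 2) by exact/cc_sqr/cc_cutoff.
have ccT i : cc (fun x => cutoff_partial Om u e i x ^+ 2).
  exact/cc_sqr/cc_cutoff_partial.
(* This is where the bound [cutoff1 ^ 2 <= cutoff1] enters. *)
have TD i : I (fun x => cutoff_partial Om u e i x ^+ 2) <= D e i.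
  apply: le_integral_cc => //; first exact: (cc_cutoff_energy openOm bdOm solu u0 e0).
  move=> x; rewrite /cutoff_partial /cutoff_energy exprMn ler_wpM2r ?sqr_ge0//.
  by rewrite expr2 ler_piMr ?cutoff1_ge0 ?cutoff1_le1.
have := comparison_integral openOm bdOm convOm solu u0 e0 delta0 delta1 a0 segOm.
have ccS : cc (fun x => \sum_(i | i != j) cutoff_partial Om u e i x ^+ 2) by exact: cc_sum.
pose G1 x := (1 - delta) ^- 2 * (\sum_(i | i != j) cutoff_partial Om u e i x ^+ 2) -
        lambda * cutoff e (uh x) ^+ 2.
pose G2 x := delta ^- 2 * cutoff e (uh x) ^+ 2.
have G1E : G1 = fun x =>
    (1 - delta) ^- 2 * (\sum_(i | i != j) cutoff_partial Om u e i x ^+ 2) +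
    (- lambda) * cutoff e (uh x) ^+ 2 by apply/funext => x; rewrite mulNr.
have ccG1 : cc G1 by rewrite G1E; apply: cc_add; exact: cc_scale.
have ccG2 : cc G2 by exact: cc_scale.
rewrite (@integral_add R n.+1 (fun X => bump a (X ord0 ord0) ^+ 2 * G1 (tail_rV X))
  (fun X => bump1 a (X ord0 ord0) ^+ 2 * G2 (tail_rV X))); last 2 first.
- by apply: (@cc_tensor _ _ (fun s => bump a s ^+ 2)) => //; exact/cc_sqr/cc_bump.
- by apply: (@cc_tensor _ _ (fun s => bump1 a s ^+ 2)) => //; exact/cc_sqr/cc_bump1.
rewrite (@integral_tensor _ _ (fun s => bump a s ^+ 2))//; last exact/cc_sqr/cc_bump.
rewrite (@integral_tensor _ _ (fun s => bump1 a s ^+ 2))//; last exact/cc_sqr/cc_bump1.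
rewrite -/A -/B integral_scale// -/P.
rewrite G1E integral_add; [|exact: cc_scale|exact: cc_scale].
rewrite !integral_scale// integral_sum// -/P.
set T := \sum_(i | i != j) _; set DD := \sum_(i | i != j) _ => h.
have TDD : T <= DD by apply: ler_sum => i _; exact: TD.
rewrite -(pmulr_rge0 _ A0); apply: le_trans h _.
have d2 : 0 <= delta ^- 2 * P by rewrite mulr_ge0// invr_ge0 sqr_ge0.
have h1 : B * (delta ^- 2 * P) <= (128 / a ^+ 2 * A) * (delta ^- 2 * P).
  exact: ler_wpM2r.
have h2 : A * ((1 - delta) ^- 2 * T) <= A * ((1 - delta) ^- 2 * DD).
  by rewrite ler_pM2l// ler_wpM2l// invr_ge0 sqr_ge0.
rewrite [leLHS](_ : _ = A * ((1 - delta) ^- 2 * T) + B * (delta ^- 2 * P) -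
   A * lambda * P); last by ring.
rewrite [leRHS](_ : _ = A * ((1 - delta) ^- 2 * DD) +
   (128 / a ^+ 2 * A) * (delta ^- 2 * P) - A * lambda * P); last by ring.
by rewrite lerD2r lerD.
Qed.

(** Eliminates the energies in the other directions between the energy identity
    and [comparison_energy].  The term with the factor [e] is the price for
    replacing [u] by its truncation. *)
Lemma cutoff_energy_bound Lambda e : 0 < e -> 0 <= Lambda -> lambda <= Lambda ->
  D e j <= (2 * delta * Lambda + 128 / a ^+ 2 / delta ^+ 2) * I (fun x => uh x ^+ 2)
    + e * (4 * Lambda * I uh).
Proof.
move=> e0 L0 lL.
have sumD := sum_cutoff_energy openOm bdOm solu u0 e0.
set Q := I (fun x => cutoff e (uh x) * uh x) in sumD.
have D0 i : 0 <= D e i.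
  by apply: Rintegral_ge0 => x _; rewrite mulr_ge0 ?sqr_ge0 ?cutoff1_ge0.
have Q0 : 0 <= Q.
  by apply: Rintegral_ge0 => x _; rewrite mulr_ge0 ?cutoff_ge0 ?ext0_ge0.
have ccu2 : cc (fun x => uh x ^+ 2) by exact/cc_sqr/cc_ext0.
have ccP : cc (fun x => cutoff e (uh x) ^+ 2) by exact/cc_sqr/cc_cutoff.
set V := I (fun x => uh x ^+ 2); set W := I uh.
have V0 : 0 <= V by apply: Rintegral_ge0 => x _; exact: sqr_ge0.
have W0 : 0 <= W by apply: Rintegral_ge0 => x _; exact: ext0_ge0.
have k0 : 0 <= 128 / a ^+ 2 / delta ^+ 2 by rewrite !divr_ge0 ?sqr_ge0.
rewrite (bigD1 j)//= -/(D e j) in sumD.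
have rest0 : 0 <= \sum_(i | i != j) D e i by exact: sumr_ge0.
(* For [lambda <= 0] the energy identity alone bounds every [D e i] by 0. *)
have [l0|l0] := leP lambda 0.
  have : D e j <= 0.
    apply: (@le_trans _ _ (D e j + \sum_(i | i != j) D e i)); first by rewrite lerDl.
    by rewrite sumD mulr_le0_ge0.
  move/le_trans; apply; apply: addr_ge0.
    by apply: mulr_ge0 => //; apply: addr_ge0 => //; rewrite !mulr_ge0 ?(ltW delta0).
  by rewrite mulr_ge0 ?(ltW e0)// mulr_ge0// mulr_ge0.
have cmp := comparison_energy e0; set P := I (fun x => cutoff e (uh x) ^+ 2) in cmp.
have QV : Q <= V.
  apply: le_integral_cc => //.
    exact: (@cc_cutoff_mul _ _ _ _ _ openOm bdOm solu u0 e e0 uh (fun x _ => @cuh x)).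
  by move=> x; rewrite expr2 ler_wpM2r ?cutoff_le ?ext0_ge0.
have PV : P <= V.
  apply: le_integral_cc => // x.
  by rewrite ler_pXn2r ?nnegrE ?cutoff_ge0 ?cutoff_le ?ext0_ge0.
have VP : V <= P + e * (4 * W).
  have ccW : cc (fun x => 4 * uh x) by exact/cc_scale/cc_ext0.
  rewrite -(integral_scale 4 cc_ext0) -(integral_scale e ccW) -integral_add//; last exact: cc_scale.
  apply: le_integral_cc => //; first by apply: cc_add => //; exact: cc_scale.
  move=> x; have ux := ext0_ge0 u0 x; have h1 := cutoff_ge e0 ux.
  have h2 := cutoff_ge0 e ux; move: h1 h2; set p := cutoff _ _; set v := uh x in ux *.
  move=> h1 h2; have [ev|ve] := leP (2 * e) v; last by nra.
  have : (v - 2 * e) ^+ 2 <= p ^+ 2.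
    by rewrite ler_pXn2r// nnegrE subr_ge0.
  nra.
have dd : 0 < (1 - delta) ^+ 2 by rewrite exprn_gt0// subr_gt0.
set r := \sum_(i | i != j) D e i in sumD rest0 cmp.
set k := 128 / a ^+ 2 / delta ^+ 2 in k0 cmp *.
have P0 : 0 <= P by apply: Rintegral_ge0 => x _; exact: sqr_ge0.
have h1 : 0 <= r + (1 - delta) ^+ 2 * ((k - lambda) * P).
  have := mulr_ge0 (ltW dd) cmp.
  by rewrite mulrDr mulrA divff ?mul1r// gt_eqF.
have DE : D e j = lambda * Q - r by rewrite -sumD addrK.
have dd1 : (1 - delta) ^+ 2 <= 1.
  by rewrite expr_le1 ?gerBl ?(ltW delta0)// subr_ge0 ltW.
have h2 : D e j <= lambda * Q + (1 - delta) ^+ 2 * (k * P) - (1 - delta) ^+ 2 * (lambda * P).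
  rewrite DE -subr_ge0; apply: le_trans h1 _.
  by rewrite le_eqVlt; apply/orP; left; apply/eqP; ring.
have h3 : lambda * Q <= lambda * V by rewrite ler_pM2l; [exact: QV|exact: l0].
have h4 : (1 - delta) ^+ 2 * (k * P) <= k * V.
  apply: (@le_trans _ _ (k * P)); last by rewrite ler_wpM2l.
  by rewrite ler_piMl// mulr_ge0.
have h5 : (1 - delta) ^+ 2 * (lambda * V) <=
    (1 - delta) ^+ 2 * (lambda * P) + lambda * (e * (4 * W)).
  apply: (@le_trans _ _ ((1 - delta) ^+ 2 * (lambda * (P + e * (4 * W))))).
    by rewrite ler_pM2l// ler_pM2l.
  rewrite mulrDr mulrDr lerD2l ler_piMl// mulr_ge0// ?(ltW l0)// mulr_ge0 ?(ltW e0)//.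
  by rewrite mulr_ge0.
have h6 : lambda * V - (1 - delta) ^+ 2 * (lambda * V) <= 2 * delta * (Lambda * V).
  have : lambda * V <= Lambda * V by rewrite ler_wpM2r.
  have : 0 <= lambda * V by rewrite mulr_ge0// ltW.
  move: (lambda * V) (Lambda * V) => x y x0 xy.
  rewrite (_ : _ - _ = (2 * delta - delta ^+ 2) * x); last by ring.
  apply: (@le_trans _ _ (2 * delta * x)).
    by rewrite ler_wpM2r// gerBl sqr_ge0.
  by rewrite ler_pM2l// mulr_gt0.
have h7 : lambda * (e * (4 * W)) <= e * (4 * Lambda * W).
  rewrite [leRHS](_ : _ = Lambda * (e * (4 * W))); last by ring.
  by rewrite ler_wpM2r// mulr_ge0 ?(ltW e0)// mulr_ge0.
rewrite mulrDl -[2 * delta * Lambda * V]mulrA; lra.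
Qed.

(** Monotone convergence, the derivative of the cutoff increasing to 1. *)
Lemma partial_energy_bound Lambda : 0 <= Lambda -> lambda <= Lambda ->
  (\int[lebesgue_rV n]_x (((partial j u \_ Om) x) ^+ 2)%:E <=
   ((2 * delta * Lambda + 128 / a ^+ 2 / delta ^+ 2) * I (fun x => uh x ^+ 2))%:E)%E.
Proof.
move=> L0 lL; set K := (_ + _) * _.
pose e k : R := k.+1%:R^-1.
have e0 k : 0 < e k by rewrite invr_gt0.
pose f k x := (cutoff_energy Om u (e k) j x)%:E.
have ccf k := cc_cutoff_energy openOm bdOm solu u0 (e0 k) j.
have mf k : measurable_fun setT (f k) by case/integrableP: (cc_integrable (ccf k)).
have f0 k x : setT x -> (0 <= f k x)%E.
  by move=> _; rewrite lee_fin mulr_ge0 ?sqr_ge0 ?cutoff1_ge0.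
have ndf x : setT x -> nondecreasing_seq (f ^~ x).
  move=> _ k l kl; rewrite lee_fin ler_wpM2r ?sqr_ge0// cutoff1_nincr//.
  by rewrite lef_pV2 ?posrE// ler_nat.
have cvf x : f k x @[k --> \oo] --> (((partial j u \_ Om) x) ^+ 2)%:E.
  apply/fine_cvgP; split; first exact: nearW.
  have [Ox|nOx] := pselect (Om x).
    rewrite patchE mem_set// -[X in _ --> X]mul1r.
    apply: cvgMl; apply: cutoff1_cvg; by rewrite ext0E// u0.
  rewrite patchE memNset// expr0n /=.
  rewrite (_ : (fun k => _) = fun=> 0); first exact: cvg_cst.
  by apply/funext => k; rewrite /f /= /cutoff_energy ext0_out// cutoff1_eq0 ?mul0r// ltW.
rewrite (eq_integral (fun x => limn (f ^~ x))); last first.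
  by move=> x _; apply/esym/cvg_lim => //; exact: cvf.
have cvI := @cvg_monotone_convergence _ _ R (lebesgue_rV n) setT measurableT f mf f0 ndf.
apply/lee_addgt0Pr => t t0.
have If k : (\int[lebesgue_rV n]_x f k x = (I (cutoff_energy Om u (e k) j))%:E)%E.
  by rewrite /Rintegral fineK// integrable_fin_num//; exact: cc_integrable.
set W := 4 * Lambda * I uh.
have W0 : 0 <= W.
  by rewrite mulr_ge0 ?mulr_ge0//; apply: Rintegral_ge0 => x _; exact: ext0_ge0.
have W1 : 0 < W + 1 by rewrite ltr_pwDr.
rewrite -(cvg_lim _ cvI)//; apply: lime_le; first by apply/cvg_ex; eexists; exact: cvI.
have tW : 0 < t / (W + 1) by rewrite divr_gt0.
near=> k; rewrite If -EFinD lee_fin.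
apply: le_trans (cutoff_energy_bound (e0 k) L0 lL) _; rewrite -/K -/W lerD2l.
have ek : e k < t / (W + 1).
  near: k; exact: (near_infty_natSinv_lt (PosNum tW)).
apply: (@le_trans _ _ (t / (W + 1) * (W + 1))).
  by apply: ler_pM; rewrite ?(ltW ek) ?(ltW (e0 k))// lerDl.
by rewrite divfK// gt_eqF.
Unshelve. all: by end_near. Qed.

End energy_bound.

Lemma L2normE {R : realType} {n} (Om : set 'rV[R]_n) (f : 'rV[R]_n -> R) :
  L2norm Om f = ((\int[lebesgue_rV n]_x ((f \_ Om) x ^+ 2)%:E) `^ 2^-1)%E.
Proof.
rewrite /L2norm unlock; congr (_ `^ _)%E; apply: eq_integral => x _ /=.
by rewrite powR_mulrn// real_normK ?num_real.
Qed.

Lemma ball_sub_axis_ellipsoid {R : realType} n (c : 'rV[R]_n.+1) (N : 'I_n.+1 -> R) :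
  (forall j, 0 < N j) -> (forall j, N ord_max <= N j) ->
  [set x : 'rV[R]_n.+1 | \sum_i (x ord0 i - c ord0 i) ^+ 2 <= (N ord_max / 4) ^+ 2]
    `<=` axis_ellipsoid c N.
Proof.
move=> N0 Nmin x /= hx; rewrite /axis_ellipsoid /=.
have N2 : 0 < (N ord_max / 2) ^+ 2 by rewrite exprn_gt0// divr_gt0.
apply: (@le_lt_trans _ _ (\sum_j (x ord0 j - c ord0 j) ^+ 2 / (N ord_max / 2) ^+ 2)).
  apply: ler_sum => j _; rewrite expr_div_n ler_wpM2l ?sqr_ge0//.
  rewrite lef_pV2 ?posrE ?exprn_gt0 ?divr_gt0//.
  by rewrite ler_pXn2r ?nnegrE ?divr_ge0 ?(ltW (N0 _))// ler_pM2r// invr_gt0.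
rewrite -mulr_suml ltr_pdivrMr// mul1r; apply: le_lt_trans hx _.
by rewrite ltr_pXn2r ?nnegrE ?divr_ge0 ?(ltW (N0 _))// ltr_pM2l// ltf_pV2 ?posrE// ltr_nat.
Qed.

Lemma segment_sub_axis_ellipsoid {R : realType} n (c : 'rV[R]_n) (N : 'I_n -> R) j s :
  0 < N j -> `|s| <= N j / 4 -> axis_ellipsoid c N (c + s *: delta_mx ord0 j).
Proof.
move=> N0 hs; rewrite /axis_ellipsoid /= (bigD1 j)//= big1 => [|i ij].
  have -> : (c + s *: delta_mx ord0 j) ord0 j - c ord0 j = s.
    by rewrite !mxE !eqxx /=; ring.
  rewrite addr0.
  rewrite -real_normK ?num_real// expr_lt1// normrM normfV (@gtr0_norm _ (N j / 2)) ?divr_gt0//.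
  by rewrite ltr_pdivrMr ?divr_gt0// mul1r; lra.
by rewrite !mxE (negbTE ij) andbF mulr0 addr0 subrr mul0r expr0n.
Qed.

Theorem theorem1p2 (R : realType) (n : nat) :
  exists C : R,
    forall (Omega : set 'rV[R]_n.+1) (c : 'rV[R]_n.+1) (N : 'I_n.+1 -> R)
           (u : 'rV[R]_n.+1 -> R),
      open Omega -> convex_set Omega -> bounded_set Omega ->
      (forall j, 0 < N j) ->
      (forall i j : 'I_n.+1, (i <= j)%N -> N j <= N i) ->
      john_ellipsoid Omega c (axis_ellipsoid c N) ->
      first_dirichlet_eigenfunction Omega u ->
      forall j : 'I_n.+1,
        (L2norm Omega (partial j u) <=
         (C * (N ord_max)^-1 * (N j / N ord_max) `^ (- 3^-1))%:E
           * L2norm Omega u)%E.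
Proof.
pose C0 : R := 8 * n.+3%:R ^+ 2 + 2 ^+ 13.
have C00 : 0 < C0 by rewrite ltr_wpDl ?mulr_ge0 ?sqr_ge0 ?exprn_gt0.
exists (Num.sqrt C0) => Om c N u oOm cOm bOm N0 Nmon [KOm _] [lambda _ [sol u0]] j.
set M := N ord_max; have M0 : 0 < M by exact: N0.
have MN i : M <= N i by apply: Nmon; rewrite -ltnS ltn_ord.
set r := N j / M; have r1 : 1 <= r by rewrite ler_pdivlMr// mul1r.
have r0 : 0 < r by rewrite (lt_le_trans ltr01).
(* Below, [delta] is [y ^ 2 / 2]: the exponent balances the two terms of the
   energy bound, and the factor 1/2 keeps [delta < 1] even when [r = 1]. *)
set y := r `^ (- 3^-1); have y0 : 0 < y by exact: powR_gt0.
have y3 : y ^+ 3 = r^-1.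
  rewrite -powR_mulrn ?(ltW y0)// -powRrM mulNr mulVf// powR_inv1//; exact: ltW.
have y1 : y <= 1.
  have := y3; have : r^-1 <= 1 by rewrite invf_le1.
  by move=> + E; rewrite -E => h; rewrite leNgt; apply/negP => y1; nra.
pose delta := y ^+ 2 / 2.
have delta0 : 0 < delta by rewrite divr_gt0 ?exprn_gt0.
have delta1 : delta < 1 by rewrite /delta; nra.
pose a := N j / 4; have a0 : 0 < a by rewrite divr_gt0.
have seg s : `|s| <= a -> Om (c + s *: delta_mx ord0 j).
  by move=> sa; apply: KOm; exact: segment_sub_axis_ellipsoid.
have [C2u cu eqn bdry] := sol.
pose Lambda := 8 * n.+3%:R ^+ 2 / M ^+ 2.
have L0 : 0 <= Lambda by apply: divr_ge0; [apply: mulr_ge0 => //|]; exact: sqr_ge0.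
have lL : lambda <= Lambda.
  have cu' x : Om x -> {for x, continuous u}.
    move=> Ox; have h : \forall y \near x, ext0 Om u y = u y.
      by apply: filterS (near_Om oOm Ox) => z Oz; rewrite ext0E.
    rewrite /prop_for /continuous_at -(ext0E u Ox).
    apply: cvg_trans (near_eq_cvg h) _; exact: (cont_ext0 oOm sol).
  have M4 : 0 < M / 4 by rewrite divr_gt0.
  have := eigenvalue_ball_bound C2u cu' eqn u0 M4
    (subset_trans (ball_sub_axis_ellipsoid N0 MN) KOm).
  move/le_trans; apply; rewrite le_eqVlt; apply/orP; left; apply/eqP.
  by rewrite /Lambda; field; rewrite gt_eqF.
have E := partial_energy_bound oOm bOm cOm sol u0 delta0 delta1 a0 seg L0 lL.
have KE : 2 * delta * Lambda + 128 / a ^+ 2 / delta ^+ 2 = C0 * (y / M) ^+ 2.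
  have NE : N j = (y ^+ 3)^-1 * M by rewrite y3 invrK /r divfK// gt_eqF.
  rewrite /delta /Lambda /a /C0 NE; field.
  by rewrite !gt_eqF.
rewrite KE in E; set V := \int[_]_x _ in E.
have V0 : 0 <= V by apply: Rintegral_ge0 => x _; exact: sqr_ge0.
have uV : (\int[lebesgue_rV n.+1]_x ((u \_ Om) x ^+ 2)%:E = V%:E)%E.
  by rewrite /V /Rintegral fineK// integrable_fin_num//;
    apply: cc_integrable; exact: (cc_sqr (cc_ext0 oOm bOm sol)).
rewrite !L2normE uV poweR_EFin -EFinM.
apply: (@le_trans _ _ ((C0 * (y / M) ^+ 2 * V)%:E `^ 2^-1)%E).
  apply: (@gt0_ler_poweR _ 2^-1) => //; rewrite in_itv /= leey andbT.
    by apply: integral_ge0 => x _; rewrite lee_fin sqr_ge0.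
  rewrite lee_fin; apply: mulr_ge0 => //.
  by apply: mulr_ge0; [exact: ltW|exact: sqr_ge0].
rewrite poweR_EFin lee_fin !powR12_sqrt//; last first.
  by rewrite mulr_ge0// mulr_ge0 ?sqr_ge0 ?(ltW C00).
have sM (x z : R) : 0 <= x -> Num.sqrt (x * z) = Num.sqrt x * Num.sqrt z.
  exact: sqrtrM.
rewrite sM; last by apply: mulr_ge0; [exact: ltW|exact: sqr_ge0].
rewrite sM; last exact: ltW.
rewrite sqrtr_sqr ger0_norm; last by apply: divr_ge0; exact: ltW.
by rewrite le_eqVlt; apply/orP; left; apply/eqP; ring.
Qed.
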